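(* Let $a\in\mathbb{R}$ and $b\in\mathbb{C}$. There exists a stable degree one symmetric polynomial $p(z_1,z_2,z_3)=p_0+p_1(z_1+z_2+z_3)$ in $d=3$ variables such that $$\widehat{\frac{1}{|p|^2}}(0,0,0)=a,\qquad \widehat{\frac{1}{|p|^2}}(1,0,0)=b$$ if and only if $|b|<a$. In that case, one finds the polynomial $p(z)=p_0+p_1(z_1+z_2+z_3)$ by determining $c\ge 0$ such that $$\frac{a(a+2c)}{a^2+2ac-3|b|^2}=\frac{(a+2c)^2}{(a+2c)^2-3|b|^2}\;{}_2F_1\!\left(\tfrac13,\tfrac23;1;\ \frac{27|b|^4\left((a+2c)^2-|b|^2\right)}{\left((a+2c)^2-3|b|^2\right)^3}\right)$$ and such that the matrix $$\begin{bmatrix} a&\bar b&\bar b&\bar b\\ b&a&c&c\\ b&c&a&c\\ b&c&c&a\end{bmatrix}$$ is positive definite (such a $c$ exists). Then a solution $p(z)$ is found via the equation $$\begin{bmatrix} a&\bar b&\bar b&\bar b\\ b&a&c&c\\ b&c&a&c\\ b&c&c&a\end{bmatrix}\begin{bmatrix}|p_0|^2\\ p_1\overline{p_0}\\ p_1\overline{p_0}\\ p_1\overline{p_0}\end{bmatrix}=\begin{bmatrix}1\\0\\0\\0\end{bmatrix}.$$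
   Context: A degree one symmetric polynomial in $d$ variables is a polynomial of the form $p(z_1,\ldots,z_d)=p_0+p_1(z_1+\cdots+z_d)$ with $p_0,p_1\in\mathbb{C}$ (the case $p_1=0$ is allowed). It is called stable if it has no roots in the closed polydisk $\{(z_1,\ldots,z_d)\in\mathbb{C}^d: |z_j|\le 1 \text{ for all } j\}$. For a function $f$ on the torus $\mathbb{T}^d=\{z\in\mathbb{C}^d:|z_j|=1\text{ for all }j\}$, $\widehat f(k)$ denotes its $k$th Fourier coefficient, $k\in\mathbb{Z}^d$, i.e. the coefficient of $z^k=z_1^{k_1}\cdots z_d^{k_d}$ in the Fourier series $f(z)=\sum_{k}\widehat f(k)z^k$. The hypergeometric function is defined for $|z|<1$ by ${}_2F_1(\alpha,\beta;\gamma;z)=\sum_{n=0}^\infty\frac{(\alpha)_n(\beta)_n}{(\gamma)_n}\frac{z^n}{n!}$, where $(q)_0=1$ and $(q)_n=q(q+1)\cdots(q+n-1)$ for $n\ge1$; thus the equation for $c$ is understood to include the requirement that the argument of ${}_2F_1$ has absolute value less than $1$. *)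

(* Defs.v *)
(* Stdlib reals with Coquelicot: complex numbers [C], total integrals [RInt]
   and series [Series], matrices of Hierarchy. *)
From Stdlib Require Import Reals ZArith List.
From Coquelicot Require Import Coquelicot.
Import ListNotations.
Open Scope R_scope.

Definition sympoly (p0 p1 z1 z2 z3 : C) : C :=
  (p0 + p1 * (z1 + z2 + z3))%C.

Definition stable (p0 p1 : C) : Prop :=
  forall z1 z2 z3 : C, Cmod z1 <= 1 -> Cmod z2 <= 1 -> Cmod z3 <= 1 ->
    sympoly p0 p1 z1 z2 z3 <> RtoC 0.

Definition cis (t : R) : C := (cos t, sin t).

Definition C_RInt (f : R -> C) (u v : R) : C :=
  RInt (V := C_R_CompleteNormedModule) f u v.

(* Integral of f(z) z^{-k} against the normalized Lebesgue measure of the torus,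
   as an iterated Riemann integral.  [RInt] is total, so this is meaningful only
   for f regular enough, e.g. continuous on the torus. *)
Definition fourier_coeff (f : C -> C -> C -> C) (k1 k2 k3 : Z) : C :=
  (RtoC (/ (2 * PI) ^ 3) *
   C_RInt (fun t1 => C_RInt (fun t2 => C_RInt (fun t3 =>
      f (cis t1) (cis t2) (cis t3)
      * cis (- (IZR k1 * t1 + IZR k2 * t2 + IZR k3 * t3)))
    0 (2 * PI)) 0 (2 * PI)) 0 (2 * PI))%C.

(* The function 1 / |p|^2. *)
Definition inv_sqmod (p0 p1 z1 z2 z3 : C) : C :=
  RtoC (/ Cmod (sympoly p0 p1 z1 z2 z3) ^ 2).

Fixpoint pochhammer (q : R) (n : nat) : R :=
  match n with
  | O => 1
  | S m => pochhammer q m * (q + INR m)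
  end.

(* Real parameters and argument; to be used only for |z| < 1, since the total
   [Series] has a junk value where the series diverges. *)
Definition hyp2F1 (alpha beta gamma z : R) : R :=
  Series (fun n => pochhammer alpha n * pochhammer beta n / pochhammer gamma n
                   * (z ^ n / INR (fact n))).

Definition matrix_of_rows (m n : nat) (rows : list (list C)) : @matrix C m n :=
  mk_matrix m n (fun i j => nth j (nth i rows []) (RtoC 0)).

Definition conj_transpose {m n : nat} (A : @matrix C m n) : @matrix C n m :=
  mk_matrix n m (fun i j => Cconj (coeff_mat (RtoC 0) A j i)).

Definition quad_form {n : nat} (A : @matrix C n n) (x : @matrix C n 1) : C :=
  coeff_mat (RtoC 0)
    (Mmult (T := C_Ring) (conj_transpose x) (Mmult (T := C_Ring) A x)) 0 0.

(* x^* A x is a positive real number for every nonzero x; over the complex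
   numbers this forces A to be Hermitian. *)
Definition pos_def {n : nat} (A : @matrix C n n) : Prop :=
  forall x : @matrix C n 1, x <> mk_matrix n 1 (fun _ _ => RtoC 0) ->
    Im (quad_form A x) = 0 /\ 0 < Re (quad_form A x).

Definition coeff_matrix (a : R) (b : C) (c : R) : @matrix C 4 4 :=
  let a' := RtoC a in let b' := Cconj b in let c' := RtoC c in
  matrix_of_rows 4 4
    [ [a'; b'; b'; b'];
      [b ; a'; c'; c'];
      [b ; c'; a'; c'];
      [b ; c'; c'; a'] ].

Definition hyp_argument (a : R) (b : C) (c : R) : R :=
  27 * Cmod b ^ 4 * ((a + 2 * c) ^ 2 - Cmod b ^ 2)
  / ((a + 2 * c) ^ 2 - 3 * Cmod b ^ 2) ^ 3.

(* With c >= 0, positive definiteness makes both denominators of the equation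
   (and that of [hyp_argument]) positive, so no division by zero occurs. *)
Definition admissible (a : R) (b : C) (c : R) : Prop :=
  0 <= c /\
  Rabs (hyp_argument a b c) < 1 /\
  a * (a + 2 * c) / (a ^ 2 + 2 * a * c - 3 * Cmod b ^ 2)
    = (a + 2 * c) ^ 2 / ((a + 2 * c) ^ 2 - 3 * Cmod b ^ 2)
      * hyp2F1 (1 / 3) (2 / 3) 1 (hyp_argument a b c) /\
  pos_def (coeff_matrix a b c).

Definition solves_matrix_equation (a : R) (b : C) (c : R) (p0 p1 : C) : Prop :=
  let u := RtoC (Cmod p0 ^ 2) in let v := (p1 * Cconj p0)%C in
  Mmult (T := C_Ring) (coeff_matrix a b c)
    (matrix_of_rows 4 1 [ [u]; [v]; [v]; [v] ])
  = matrix_of_rows 4 1 [ [RtoC 1]; [RtoC 0]; [RtoC 0]; [RtoC 0] ].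

Definition is_solution (a : R) (b : C) (p0 p1 : C) : Prop :=
  stable p0 p1 /\
  fourier_coeff (inv_sqmod p0 p1) 0 0 0 = RtoC a /\
  fourier_coeff (inv_sqmod p0 p1) 1 0 0 = b.

(* Main.v *)
Require Import Defs.
From Stdlib Require Import Reals ZArith Lra Lia Psatz Ranalysis5.
From Coquelicot Require Import Coquelicot.
From mathcomp Require binomial.
Open Scope R_scope.

(** Write [w = p1 / p0] and [x = |w|^2].  Stability of [p] means [3 |w| < 1], and
    then [1 / p] is a uniformly convergent geometric series on the torus.  With
    [A_n] the mean of [|z1 + z2 + z3|^(2n)], that is, the sum of the squares of the
    trinomial coefficients of order [n], and [F(x) = sum A_n x^n],
    [F1(x) = sum A_(n+1) x^n = (F(x) - 1) / x], integration term by term gives the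
    coefficients [F(x) / |p0|^2] at [(0,0,0)] and [- w F1(x) / (3 |p0|^2)] at
    [(1,0,0)] ([fourier_coeff_000], [fourier_coeff_100]).

    The bridge to the hypergeometric function is the cubic transformation
    [F(x) = 2F1(1/3, 2/3; 1; z) / (1 - 3 x)], [z = 27 x^2 (1 - x) / (1 - 3 x)^3], for
    [0 <= x < 1/9] ([moment_gf_hypergeometric]).  The numbers [A_n] satisfy a
    three-term recurrence ([moment3_rec], by creative telescoping), so [F] solves the
    self-adjoint equation [(P F')' = (3 - 9 x) F] with [P = x (1 - x) (1 - 9 x)].  The
    right-hand side, by Euler's equation and the chain rule, solves it as well.
    Since [P] vanishes at [0], where both functions are smooth, their Wronskian is
    zero; they are proportional, and both equal [1] at [0].

    The matrix equation says [w = - b / (a + 2 c)] and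
    [|p0|^2 = (a + 2 c) / (a (a + 2 c) - 3 |b|^2)].  As [1 - z = (1 - 9 x) / (1 - 3 x)^3],
    the condition [|z| < 1] amounts to stability, and the equation for [c] reads
    [F(x) = a |p0|^2], which is the condition at [(0,0,0)]; the one at [(1,0,0)]
    follows from [F = 1 + x F1] ([matrix_equation_solution]).

    In terms of [y = |w|], every solution has [|b| / a = y F1(y^2) / (3 F(y^2))].  The
    bound [A_(n+1) <= 9 A_n] makes this ratio smaller than [3 y < 1]
    ([solution_bound]).  Conversely [F] is unbounded near [1/9], by the logarithmic
    divergence of the hypergeometric series at [1], so the ratio takes every value
    of [(0, 1)] ([ratio_surjective]), and for [b <> 0] the number
    [c = (|b| / y - a) / 2] is then admissible; for [b = 0] so is [c = 0]
    ([admissible_exists]). *)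

(** * Trinomial moments *)

(* Turns an equation between reals seen as elements of a structure into one
   that [ring] and [field] recognize. *)
Ltac in_R :=
  change (@plus R_AbelianMonoid) with Rplus in *;
  change (@mult R_Ring) with Rmult in *;
  change (@sum_n (Ring.AbelianMonoid R_Ring)) with (@sum_n R_AbelianMonoid) in *;
  match goal with |- @eq _ ?x ?y => change (@eq R x y) end.

(** The binomial coefficient as a real number.  It vanishes for [n < k], so that
    sums of binomial terms may run over any range containing the support, and the
    ratios of neighbouring coefficients hold without restriction on the indices. *)
Definition binom (n k : nat) : R := INR (binomial.binomial n k).

Lemma binom_0_r (n : nat) : binom n 0 = 1.
Proof. unfold binom. rewrite binomial.bin0. reflexivity. Qed.

Lemma binom_0_S (k : nat) : binom 0 (S k) = 0.
Proof. reflexivity. Qed.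

Lemma binom_pascal (n k : nat) :
  binom (S n) (S k) = binom n (S k) + binom n k.
Proof. unfold binom. rewrite binomial.binS. apply plus_INR. Qed.

Lemma binom_small (n k : nat) : (n < k)%nat -> binom n k = 0.
Proof.
  revert k; induction n as [|n IH]; intros [|k] Hk; try lia.
  - apply binom_0_S.
  - rewrite binom_pascal, !IH by lia. ring.
Qed.

Lemma binom_succ_r (n k : nat) :
  (INR k + 1) * binom n (S k) = (INR n - INR k) * binom n k.
Proof.
  revert k; induction n as [|n IH]; intros k.
  - rewrite binom_0_S. destruct k as [|k].
    + rewrite binom_0_r. simpl. ring.
    + rewrite binom_0_S. ring.
  - destruct k as [|k].
    + rewrite binom_pascal, !binom_0_r, S_INR.
      specialize (IH 0%nat). rewrite binom_0_r in IH. simpl in *. lra.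
    + rewrite (binom_pascal n (S k)), (binom_pascal n k).
      pose proof (IH (S k)) as H1. pose proof (IH k) as H0.
      rewrite S_INR in *. rewrite S_INR in *. lra.
Qed.

Lemma binom_succ_l (n k : nat) :
  (INR n + 1 - INR k) * binom (S n) k = (INR n + 1) * binom n k.
Proof.
  destruct k as [|k].
  - rewrite !binom_0_r. simpl. ring.
  - rewrite binom_pascal. pose proof (binom_succ_r n k) as H.
    rewrite S_INR. lra.
Qed.

Lemma binom_pred_l (n k : nat) :
  binom n k = binom (S n) k * (INR n + 1 - INR k) / (INR n + 1).
Proof.
  pose proof (binom_succ_l n k). pose proof (pos_INR n).
  field_simplify_eq; [|lra]. lra.
Qed.

Lemma binom_next_r (n k : nat) :
  binom n (S k) = binom n k * (INR n - INR k) / (INR k + 1).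
Proof.
  pose proof (binom_succ_r n k). pose proof (pos_INR k).
  field_simplify_eq; [|lra]. lra.
Qed.

(** The symmetry of the trinomial coefficients [n! / (j! k! (n - j - k)!)]. *)
Lemma binom_swap (n j k : nat) :
  (j <= n)%nat -> (k <= n)%nat ->
  binom n j * binom (n - j) k = binom n k * binom (n - k) j.
Proof.
  intros Hj; induction k as [|k IH]; intros Hk.
  - rewrite !binom_0_r, Nat.sub_0_r. ring.
  - specialize (IH ltac:(lia)).
    pose proof (binom_succ_r (n - j) k) as H1.
    pose proof (binom_succ_r n k) as H2.
    pose proof (binom_succ_l (n - S k) j) as H3.
    replace (S (n - S k)) with (n - k)%nat in H3 by lia.
    rewrite minus_INR in H1 by lia. rewrite minus_INR, S_INR in H3 by lia.
    pose proof (pos_INR k).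
    apply Rmult_eq_reg_l with (INR k + 1); [|lra].
    transitivity (binom n j * ((INR k + 1) * binom (n - j) (S k))); [ring|].
    rewrite H1.
    transitivity ((INR n - INR k - INR j) * (binom n j * binom (n - j) k)); [ring|].
    rewrite IH.
    transitivity ((INR k + 1) * binom n (S k) * binom (n - S k) j); [|ring].
    rewrite H2.
    transitivity (binom n k * ((INR n - (INR k + 1) + 1 - INR j) * binom (n - k) j));
      [ring|].
    rewrite H3. ring.
Qed.

Lemma binom_diag (n : nat) : binom n n = 1.
Proof.
  induction n as [|n IH]; [apply binom_0_r|].
  rewrite binom_pascal, IH, binom_small by lia. ring.
Qed.

Lemma binom_refl (n k : nat) : (k <= n)%nat -> binom n (n - k) = binom n k.
Proof.
  intros Hk. pose proof (binom_swap n (n - k) k ltac:(lia) Hk) as H.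
  replace (n - (n - k))%nat with k in H by lia.
  rewrite !binom_diag in H. lra.
Qed.

Lemma sum_n_telescope (u : nat -> R) (n : nat) :
  sum_n (fun k => u (S k) - u k) n = u (S n) - u 0%nat.
Proof.
  induction n as [|n IH].
  - now rewrite sum_O.
  - rewrite sum_Sn, IH. in_R. ring.
Qed.

Lemma sum_n_lin (a b : R) (u v : nat -> R) (n : nat) :
  sum_n (fun k => a * u k + b * v k) n = a * sum_n u n + b * sum_n v n.
Proof.
  induction n as [|n IH].
  - now rewrite !sum_O.
  - rewrite !sum_Sn, IH. in_R. ring.
Qed.

Lemma sum_n_0_tail (u : nat -> R) (n m : nat) :
  (n <= m)%nat -> (forall k, (n < k)%nat -> u k = 0) -> sum_n u m = sum_n u n.
Proof.
  intros Hnm Hu; induction Hnm as [|m Hnm IH]; [reflexivity|].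
  rewrite sum_Sn, IH, Hu by lia. apply Rplus_0_r.
Qed.

Lemma sum_n_rev (u : nat -> R) (n : nat) :
  sum_n (fun k => u (n - k)%nat) n = sum_n u n.
Proof.
  revert u; induction n as [|n IH]; intros u.
  - now rewrite !sum_O.
  - rewrite sum_Sn, Nat.sub_diag.
    rewrite (sum_n_ext_loc _ (fun k => u (S (n - k)))).
    2:{ intros k Hk. f_equal. lia. }
    rewrite (IH (fun k => u (S k))).
    unfold sum_n at 2. rewrite sum_Sn_m by lia.
    unfold sum_n. rewrite sum_n_m_S. apply Rplus_comm.
Qed.

Lemma sum_n_ge_head (u : nat -> R) (n : nat) :
  (forall k, 0 <= u k) -> u 0%nat <= sum_n u n.
Proof.
  intros Hu; induction n as [|n IH].
  - rewrite sum_O. apply Rle_refl.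
  - rewrite sum_Sn. change plus with Rplus. pose proof (Hu (S n)). lra.
Qed.

(** The mean of [|z1 + z2|^(2m)] over the torus. *)
Definition moment2 (m : nat) : R := sum_n (fun k => binom m k ^ 2) m.

(** The mean of [|z1 + z2 + z3|^(2n)] over the torus, that is, the sum of the
    squares of the trinomial coefficients of order [n]. *)
Definition moment3 (n : nat) : R :=
  sum_n (fun j => sum_n (fun k => (binom n j * binom (n - j) k) ^ 2) n) n.

(** The recurrence of the central binomial coefficients, by creative telescoping:
    [G] is the certificate of the summand [binom m k ^ 2]. *)
Lemma moment2_succ (m : nat) :
  (INR m + 1) * moment2 (S m) = (4 * INR m + 2) * moment2 m.
Proof.
  pose proof (pos_INR m) as Hm.
  set (G := fun k => (2 * INR k - 3 * INR m - 3) / (INR m + 1) ^ 2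
                     * (INR k * binom (S m) k) ^ 2).
  assert (HG : sum_n (fun k => G (S k) - G k) (S m) = 0).
  { rewrite sum_n_telescope. unfold G. rewrite (binom_small (S m) (S (S m))) by lia.
    simpl INR. in_R. ring. }
  assert (H : (INR m + 1) * moment2 (S m) - (4 * INR m + 2) * moment2 m = 0).
  { rewrite <- HG. unfold moment2 at 2.
    rewrite <- (sum_n_0_tail (fun k => binom m k ^ 2) m (S m)) by
      (try lia; intros k Hk; rewrite binom_small by lia; ring).
    unfold moment2, Rminus. rewrite Ropp_mult_distr_l, <- sum_n_lin.
    apply sum_n_ext. intros k. unfold G.
    rewrite (binom_pred_l m k), (binom_next_r (S m) k), !S_INR.
    pose proof (pos_INR k). in_R. field. lra. }
  lra.
Qed.

Lemma moment3_single (n : nat) :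
  moment3 n = sum_n (fun k => binom n k ^ 2 * moment2 k) n.
Proof.
  unfold moment3. rewrite <- (sum_n_rev _ n). apply sum_n_ext_loc. intros k Hk.
  replace (n - (n - k))%nat with k by lia.
  rewrite (sum_n_ext _ (fun i => mult (binom n k ^ 2) (binom k i ^ 2))).
  - rewrite (sum_n_mult_l (K := R_Ring)). in_R. f_equal.
    apply sum_n_0_tail; [lia|]. intros i Hi. rewrite binom_small by lia. ring.
  - intros i. in_R. rewrite Rpow_mult_distr, binom_refl by lia. reflexivity.
Qed.

(** The recurrence of the moments, by creative telescoping: [G] is the certificate
    of the summand [binom n k ^ 2 * moment2 k]. *)
Lemma moment3_rec (n : nat) :
  (INR n + 2) ^ 2 * moment3 (S (S n))
  = (10 * INR n ^ 2 + 30 * INR n + 23) * moment3 (S n)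
    - 9 * (INR n + 1) ^ 2 * moment3 n.
Proof.
  pose proof (pos_INR n) as Hn.
  set (G := fun k => (3 * INR k - 4 * (INR n + 2)) / (INR n + 2) ^ 2
                     * INR k ^ 3 * binom (S (S n)) k ^ 2 * moment2 k).
  assert (HG : sum_n (fun k => G (S k) - G k) (S (S n)) = 0).
  { rewrite sum_n_telescope. unfold G. rewrite binom_small by lia.
    change (INR 0) with 0. in_R. ring. }
  assert (H : 1 * ((INR n + 2) ^ 2 * moment3 (S (S n))
               + - (10 * INR n ^ 2 + 30 * INR n + 23) * moment3 (S n))
            + 9 * (INR n + 1) ^ 2 * moment3 n = 0).
  { rewrite <- HG, !moment3_single.
    rewrite <- (sum_n_0_tail (fun k => binom n k ^ 2 * moment2 k) n (S (S n))) by
      (try lia; intros k Hk; rewrite binom_small by lia; ring).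
    rewrite <- (sum_n_0_tail (fun k => binom (S n) k ^ 2 * moment2 k) (S n) (S (S n))) by
      (try lia; intros k Hk; rewrite binom_small by lia; ring).
    rewrite <- sum_n_lin, <- sum_n_lin.
    apply sum_n_ext. intros k. unfold G. pose proof (pos_INR k) as Hk.
    assert (E : moment2 (S k) = (4 * INR k + 2) * moment2 k / (INR k + 1)).
    { rewrite <- moment2_succ. field. lra. }
    rewrite E.
    rewrite (binom_pred_l n k), (binom_pred_l (S n) k), (binom_next_r (S (S n)) k), !S_INR.
    in_R. field. lra. }
  lra.
Qed.

Lemma moment3_0 : moment3 0 = 1.
Proof. unfold moment3. rewrite !sum_O. simpl Nat.sub. rewrite binom_0_r. ring. Qed.

Lemma moment3_1 : moment3 1 = 3.
Proof.
  rewrite moment3_single, sum_Sn, sum_O. unfold moment2.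
  rewrite sum_Sn, !sum_O, binom_pascal, !binom_0_r, binom_0_S.
  in_R. ring.
Qed.

Lemma moment3_ge_1 (n : nat) : 1 <= moment3 n.
Proof.
  rewrite moment3_single.
  apply Rle_trans with (binom n 0 ^ 2 * moment2 0).
  - unfold moment2. rewrite sum_O, !binom_0_r. lra.
  - apply (sum_n_ge_head (fun k => binom n k ^ 2 * moment2 k)). intros k.
    apply Rmult_le_pos; [apply pow2_ge_0|].
    eapply Rle_trans; [|apply sum_n_ge_head; intros; apply pow2_ge_0].
    apply pow2_ge_0.
Qed.

Lemma moment3_growth (n : nat) : moment3 (S n) <= 9 * moment3 n.
Proof.
  induction n as [|n IH].
  - rewrite moment3_0, moment3_1. lra.
  - pose proof (moment3_rec n) as H. pose proof (pos_INR n) as Hn.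
    pose proof (moment3_ge_1 (S n)) as H1.
    apply Rmult_le_reg_l with ((INR n + 2) ^ 2); [nra|]. rewrite H.
    assert ((INR n + 1) ^ 2 * moment3 (S n) <= (INR n + 1) ^ 2 * (9 * moment3 n)).
    { apply Rmult_le_compat_l; [nra|exact IH]. }
    nra.
Qed.

(** The sum of the products of corresponding trinomial coefficients of orders
    [n] and [m], over the box of side [N], which contains all of them as soon as
    [n <= N] or [m <= N]. *)
Definition moment3_pair (n m N : nat) : R :=
  sum_n (fun j => sum_n (fun k =>
    (binom n j * binom (n - j) k) * (binom m j * binom (m - j) k)) N) N.

(** The average of [k] with weights [binom m k ^ 2] is [m / 2]; by telescoping. *)
Lemma binom_sq_mean (m N : nat) :
  (m <= N)%nat ->
  2 * sum_n (fun k => INR k * binom m k ^ 2) N = INR m * sum_n (fun k => binom m k ^ 2) N.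
Proof.
  intros HmN.
  rewrite !(sum_n_0_tail _ m N) by
    (try lia; intros k Hk; rewrite binom_small by lia; ring).
  destruct m as [|m].
  { rewrite !sum_O. simpl INR. ring. }
  set (G := fun k => (INR k * binom (S m) k) ^ 2 / INR (S m)).
  assert (HG : sum_n (fun k => G (S k) - G k) (S m) = 0).
  { rewrite sum_n_telescope. unfold G. rewrite (binom_small (S m) (S (S m))) by lia.
    simpl (INR 0). in_R. field. apply not_0_INR. lia. }
  assert (H : INR (S m) * sum_n (fun k => binom (S m) k ^ 2) (S m)
    + (-2) * sum_n (fun k => INR k * binom (S m) k ^ 2) (S m) = 0).
  { rewrite <- HG, <- sum_n_lin. apply sum_n_ext. intros k. unfold G.
    rewrite (binom_next_r (S m) k), (S_INR k).
    pose proof (pos_INR k). pose proof (lt_0_INR (S m) ltac:(lia)). in_R. field. lra. }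
  lra.
Qed.

(** With weights the squared trinomial coefficients of order [n + 1], the three
    exponents have the same average, hence the factor [3]. *)
Lemma moment3_pair_succ_thrice (n : nat) :
  3 * moment3_pair (S n) n (S n) = moment3 (S n).
Proof.
  set (N := S n).
  set (T := fun j k => binom N j * binom (N - j) k).
  set (S1 := sum_n (fun j => INR j * sum_n (fun k => T j k ^ 2) N) N).
  set (S2 := sum_n (fun j => sum_n (fun k => INR k * T j k ^ 2) N) N).
  assert (E12 : S1 = S2).
  { unfold S2. rewrite sum_n_switch. unfold S1. apply sum_n_ext_loc. intros j Hj.
    rewrite <- (sum_n_mult_l (K := R_Ring)). apply sum_n_ext_loc. intros k Hk.
    unfold T. rewrite (binom_swap N j k) by lia. reflexivity. }
  assert (E2 : INR N * moment3 N + (-1) * S1 = 2 * S2).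
  { unfold moment3, S1. rewrite <- sum_n_lin. unfold S2.
    rewrite <- (sum_n_mult_l (K := R_Ring) 2). apply sum_n_ext_loc. intros j Hj.
    transitivity (binom N j ^ 2 * (INR (N - j) * sum_n (fun k => binom (N - j) k ^ 2) N)).
    - rewrite minus_INR by lia. unfold T.
      rewrite (sum_n_ext _ (fun k => mult (binom N j ^ 2) (binom (N - j) k ^ 2)))
        by (intros k; apply Rpow_mult_distr).
      rewrite (sum_n_mult_l (K := R_Ring)). in_R. ring.
    - rewrite <- binom_sq_mean by lia. unfold T.
      rewrite (sum_n_ext (fun k => INR k * (binom N j * binom (N - j) k) ^ 2)
        (fun k => mult (binom N j ^ 2) (INR k * binom (N - j) k ^ 2)))
        by (intros k; in_R; rewrite Rpow_mult_distr; ring).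
      rewrite (sum_n_mult_l (K := R_Ring)). in_R. ring. }
  assert (E3 : INR N * moment3_pair N n N = 1 * (INR N * moment3 N + (-1) * S1) + (-1) * S2).
  { unfold moment3_pair, moment3, S1, S2. rewrite <- !sum_n_lin.
    rewrite <- (sum_n_mult_l (K := R_Ring) (INR N)). apply sum_n_ext_loc. intros j Hj.
    rewrite <- (sum_n_mult_l (K := R_Ring)).
    transitivity ((INR N - INR j) * sum_n (fun k => T j k ^ 2) N
                  + (-1) * sum_n (fun k => INR k * T j k ^ 2) N).
    2:{ unfold T. in_R. ring. }
    rewrite <- sum_n_lin. apply sum_n_ext. intros k. in_R.
    unfold T. fold N.
    pose proof (binom_succ_l n j) as H1. rewrite <- S_INR in H1. fold N in H1.
    assert (H2 : (INR N - INR j - INR k) * binom (N - j) k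
               = (INR N - INR j) * binom (n - j) k).
    { destruct (Nat.eq_dec j N) as [->|Hj'].
      - rewrite Nat.sub_diag. destruct k as [|k].
        + simpl (INR 0). rewrite !binom_0_r. ring.
        + rewrite binom_0_S. ring.
      - pose proof (binom_succ_l (n - j) k) as H2.
        replace (S (n - j)) with (N - j)%nat in H2 by lia.
        rewrite minus_INR in H2 by lia. unfold N in *. rewrite S_INR. lra. }
    transitivity (binom N j * binom (N - j) k * (INR N * binom n j) * binom (n - j) k);
      [ring|].
    rewrite <- H1.
    transitivity (binom N j ^ 2 * binom (N - j) k * ((INR N - INR j) * binom (n - j) k));
      [ring|].
    rewrite <- H2. ring. }
  assert (HN : 0 < INR N) by (apply lt_0_INR; lia).
  fold N. apply Rmult_eq_reg_l with (INR N); [|lra]. lra.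
Qed.

(** * Means over the circle and the torus *)
(* The analogue of [in_R] for complex numbers. *)
Ltac in_C :=
  change (@plus C_AbelianMonoid) with Cplus in *;
  change (@plus (Ring.AbelianMonoid C_Ring)) with Cplus in *;
  change (@mult C_Ring) with Cmult in *;
  change (@sum_n (Ring.AbelianMonoid C_Ring)) with (@sum_n C_AbelianMonoid) in *;
  match goal with |- @eq _ ?x ?y => change (@eq C x y) end.

(** [f] is Riemann integrable on a period and [l] is its mean over the circle. *)
Definition is_mean (f : R -> C) (l : C) : Prop :=
  is_RInt (V := C_R_NormedModule) f 0 (2 * PI) (RtoC (2 * PI) * l)%C.

Lemma is_mean_ext (f g : R -> C) (l : C) :
  (forall t, f t = g t) -> is_mean f l -> is_mean g l.
Proof. intros H. apply is_RInt_ext. intros t _. apply H. Qed.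

Lemma is_mean_plus (f g : R -> C) (l m : C) :
  is_mean f l -> is_mean g m -> is_mean (fun t => f t + g t)%C (l + m)%C.
Proof.
  intros Hf Hg. unfold is_mean. rewrite Cmult_plus_distr_l.
  exact (is_RInt_plus (V := C_R_NormedModule) _ _ _ _ _ _ Hf Hg).
Qed.

Lemma is_mean_scal (c : C) (f : R -> C) (l : C) :
  is_mean f l -> is_mean (fun t => c * f t)%C (c * l)%C.
Proof.
  intros Hf. unfold is_mean in *.
  pose proof (is_RInt_fct_extend_fst (U := R_NormedModule) (V := R_NormedModule) _ _ _ _ Hf) as H1.
  pose proof (is_RInt_fct_extend_snd (U := R_NormedModule) (V := R_NormedModule) _ _ _ _ Hf) as H2.
  replace (RtoC (2 * PI) * (c * l))%C with
    (fst c * fst (RtoC (2 * PI) * l)%C - snd c * snd (RtoC (2 * PI) * l)%C,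
     fst c * snd (RtoC (2 * PI) * l)%C + snd c * fst (RtoC (2 * PI) * l)%C).
  2:{ apply injective_projections; simpl; ring. }
  apply (is_RInt_fct_extend_pair (U := R_NormedModule) (V := R_NormedModule)).
  - apply (is_RInt_minus (V := R_NormedModule));
      apply (is_RInt_scal (V := R_NormedModule)); assumption.
  - apply (is_RInt_plus (V := R_NormedModule));
      apply (is_RInt_scal (V := R_NormedModule)); assumption.
Qed.

Lemma is_mean_sum (f : nat -> R -> C) (l : nat -> C) (n : nat) :
  (forall k, is_mean (f k) (l k)) ->
  is_mean (fun t => sum_n (fun k => f k t) n) (sum_n l n).
Proof.
  intros H; induction n as [|n IH].
  - rewrite sum_O. apply (is_mean_ext (f 0%nat)); [|apply H].
    intros t. now rewrite sum_O.
  - rewrite sum_Sn. apply (is_mean_ext (fun t => sum_n (fun k => f k t) n + f (S n) t)%C).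
    + intros t. now rewrite sum_Sn.
    + now apply is_mean_plus.
Qed.

Lemma is_mean_unique (f : R -> C) (l : C) :
  is_mean f l -> C_RInt f 0 (2 * PI) = (RtoC (2 * PI) * l)%C.
Proof. apply (is_RInt_unique (V := C_R_CompleteNormedModule)). Qed.

Lemma two_PI_neq_0 : RtoC (2 * PI) <> RtoC 0.
Proof. intros H. apply RtoC_inj in H. pose proof PI_RGT_0. lra. Qed.

(** The mean as a total function, meaningful when [is_mean f (mean f)]. *)
Definition mean (f : R -> C) : C := (C_RInt f 0 (2 * PI) / RtoC (2 * PI))%C.

Lemma is_mean_mean (f : R -> C) (l : C) : is_mean f l -> mean f = l.
Proof.
  intros H. unfold mean. rewrite (is_mean_unique _ _ H). field.
  apply two_PI_neq_0.
Qed.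

(** The norm of the plane as a product of two real lines is the modulus. *)
Lemma norm_C_R (z : C) : norm (V := C_R_NormedModule) z = Cmod z.
Proof.
  unfold norm, Cmod; simpl. unfold prod_norm, norm; simpl. unfold abs; simpl.
  f_equal. rewrite !Rmult_1_r. rewrite <- !Rabs_mult.
  rewrite !Rabs_pos_eq; [reflexivity|nra|nra].
Qed.

Lemma is_mean_bound (f : R -> C) (l : C) (e : R) :
  (forall t, Cmod (f t) <= e) -> is_mean f l -> Cmod l <= e.
Proof.
  intros He Hf.
  pose proof PI_RGT_0 as HPI.
  assert (H : norm (V := C_R_NormedModule) (RtoC (2 * PI) * l)%C <= (2 * PI - 0) * e).
  { apply (norm_RInt_le_const f 0 (2 * PI)); [lra| |exact Hf].
    intros t _. rewrite norm_C_R. apply He. }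
  rewrite norm_C_R, Cmod_mult, Cmod_R, Rabs_pos_eq in H by lra.
  apply Rmult_le_reg_l with (2 * PI); lra.
Qed.

(** A uniform limit of functions that have a mean has a mean, with the same bound on
    the error. *)
Lemma is_mean_lim (f : nat -> R -> C) (g : R -> C) (l : nat -> C) (e : nat -> R) :
  (forall N, is_mean (f N) (l N)) ->
  (forall N t, Cmod (f N t - g t) <= e N) ->
  is_lim_seq e 0 ->
  is_mean g (mean g) /\ forall N, Cmod (l N - mean g) <= e N.
Proof.
  intros Hf He Hlim.
  destruct (filterlim_RInt (V := C_R_CompleteNormedModule) f 0 (2 * PI) eventually
    _ g (fun N => RtoC (2 * PI) * l N)%C Hf) as [If [_ HIf]].
  { apply filterlim_locally. intros eps.
    apply is_lim_seq_spec in Hlim. destruct (Hlim eps) as [N0 HN0].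
    exists N0. intros n Hn t.
    specialize (HN0 n Hn). rewrite Rminus_0_r in HN0.
    pose proof (He n t) as H. pose proof (Rle_abs (e n)) as H'.
    pose proof (Rmax_Cmod (f n t - g t)%C) as Hm.
    pose proof (Rmax_l (Rabs (fst (f n t - g t)%C)) (Rabs (snd (f n t - g t)%C))).
    pose proof (Rmax_r (Rabs (fst (f n t - g t)%C)) (Rabs (snd (f n t - g t)%C))).
    split.
    - change (Rabs (fst (f n t - g t)%C) < eps). lra.
    - change (Rabs (snd (f n t - g t)%C) < eps). lra. }
  assert (Hg : is_mean g (mean g)).
  { unfold is_mean, mean. unfold C_RInt. rewrite (is_RInt_unique _ _ _ _ HIf).
    assert (E : forall z : C, (RtoC (2 * PI) * (z / RtoC (2 * PI)))%C = z)
      by (intros z; field; apply two_PI_neq_0).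
    rewrite (E If). exact HIf. }
  split; [exact Hg|]. intros N.
  apply (is_mean_bound (fun t => f N t - g t)%C); [intros t; apply He|].
  apply (is_mean_ext (fun t => f N t + (- RtoC 1) * g t)%C); [intros t; ring|].
  replace (l N - mean g)%C with (l N + (- RtoC 1) * mean g)%C by ring.
  apply is_mean_plus; [apply Hf|]. apply is_mean_scal, Hg.
Qed.

(** Every inner integral of the iterated integral of [f] over the torus exists, and
    [l] is the resulting mean. *)
Definition is_mean3 (f : R -> R -> R -> C) (l : C) : Prop :=
  exists (f2 : R -> R -> C) (f1 : R -> C),
    (forall t1 t2, is_mean (f t1 t2) (f2 t1 t2)) /\
    (forall t1, is_mean (f2 t1) (f1 t1)) /\ is_mean f1 l.

Lemma is_mean3_ext (f g : R -> R -> R -> C) (l : C) :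
  (forall t1 t2 t3, f t1 t2 t3 = g t1 t2 t3) -> is_mean3 f l -> is_mean3 g l.
Proof.
  intros H (f2 & f1 & H3 & H2 & H1). exists f2, f1. repeat split; auto.
  intros t1 t2. apply (is_mean_ext (f t1 t2)); auto.
Qed.

Lemma is_mean3_plus (f g : R -> R -> R -> C) (l m : C) :
  is_mean3 f l -> is_mean3 g m ->
  is_mean3 (fun t1 t2 t3 => f t1 t2 t3 + g t1 t2 t3)%C (l + m)%C.
Proof.
  intros (f2 & f1 & F3 & F2 & F1) (g2 & g1 & G3 & G2 & G1).
  exists (fun t1 t2 => f2 t1 t2 + g2 t1 t2)%C, (fun t1 => f1 t1 + g1 t1)%C.
  repeat split; intros; apply is_mean_plus; auto.
Qed.

Lemma is_mean3_scal (c : C) (f : R -> R -> R -> C) (l : C) :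
  is_mean3 f l -> is_mean3 (fun t1 t2 t3 => c * f t1 t2 t3)%C (c * l)%C.
Proof.
  intros (f2 & f1 & F3 & F2 & F1).
  exists (fun t1 t2 => c * f2 t1 t2)%C, (fun t1 => c * f1 t1)%C.
  repeat split; intros; apply is_mean_scal; auto.
Qed.

Lemma is_mean3_sum (f : nat -> R -> R -> R -> C) (l : nat -> C) (n : nat) :
  (forall k, is_mean3 (f k) (l k)) ->
  is_mean3 (fun t1 t2 t3 => sum_n (fun k => f k t1 t2 t3) n) (sum_n l n).
Proof.
  intros H; induction n as [|n IH].
  - rewrite sum_O. apply (is_mean3_ext (f 0%nat)); [|apply H].
    intros; now rewrite sum_O.
  - rewrite sum_Sn.
    apply (is_mean3_ext
      (fun t1 t2 t3 => sum_n (fun k => f k t1 t2 t3) n + f (S n) t1 t2 t3)%C).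
    + intros; now rewrite sum_Sn.
    + now apply is_mean3_plus.
Qed.

Lemma is_mean3_mean (f : R -> R -> R -> C) (l : C) :
  is_mean3 f l <->
  (forall t1 t2, is_mean (f t1 t2) (mean (f t1 t2))) /\
  (forall t1, is_mean (fun t2 => mean (f t1 t2)) (mean (fun t2 => mean (f t1 t2)))) /\
  is_mean (fun t1 => mean (fun t2 => mean (f t1 t2))) l.
Proof.
  split.
  2:{ intros (F3 & F2 & F1). eexists; eexists; split; [exact F3|split; [exact F2|exact F1]]. }
  intros (f2 & f1 & F3 & F2 & F1).
  assert (E2 : forall t1 t2, mean (f t1 t2) = f2 t1 t2)
    by (intros; now apply is_mean_mean).
  assert (F2' : forall t1, is_mean (fun t2 => mean (f t1 t2)) (f1 t1)).
  { intros t1. apply (is_mean_ext (f2 t1)); auto. }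
  assert (E1 : forall t1, mean (fun t2 => mean (f t1 t2)) = f1 t1)
    by (intros; now apply is_mean_mean).
  repeat split.
  - intros t1 t2. rewrite E2. apply F3.
  - intros t1. rewrite E1. apply F2'.
  - apply (is_mean_ext f1); auto.
Qed.

(** Only a uniform bound is needed: the integrability of the inner means of the limit
    comes from the same argument, one variable at a time. *)
Lemma is_mean3_lim (f : nat -> R -> R -> R -> C) (g : R -> R -> R -> C)
    (l : nat -> C) (e : nat -> R) :
  (forall N, is_mean3 (f N) (l N)) ->
  (forall N t1 t2 t3, Cmod (f N t1 t2 t3 - g t1 t2 t3) <= e N) ->
  is_lim_seq e 0 ->
  exists l', is_mean3 g l' /\ forall N, Cmod (l N - l') <= e N.
Proof.
  intros Hf He Hlim.
  assert (Hf' := fun N => proj1 (is_mean3_mean _ _) (Hf N)).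
  pose proof (fun t1 t2 => is_mean_lim (fun N => f N t1 t2) (g t1 t2) _ e
    (fun N => proj1 (Hf' N) t1 t2) (fun N => He N t1 t2) Hlim) as H3.
  pose proof (fun t1 => is_mean_lim _ (fun t2 => mean (g t1 t2)) _ e
    (fun N => proj1 (proj2 (Hf' N)) t1) (fun N t2 => proj2 (H3 t1 t2) N) Hlim) as H2.
  pose proof (is_mean_lim _ (fun t1 => mean (fun t2 => mean (g t1 t2))) _ e
    (fun N => proj2 (proj2 (Hf' N))) (fun N t1 => proj2 (H2 t1) N) Hlim) as H1.
  eexists. split; [|exact (proj2 H1)].
  apply is_mean3_mean. repeat split.
  - intros t1 t2. apply H3.
  - intros t1. apply H2.
  - apply H1.
Qed.

Lemma is_mean3_fourier (f : C -> C -> C -> C) (k1 k2 k3 : Z) (l : C) :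
  is_mean3 (fun t1 t2 t3 => f (cis t1) (cis t2) (cis t3)
      * cis (- (IZR k1 * t1 + IZR k2 * t2 + IZR k3 * t3)))%C l ->
  fourier_coeff f k1 k2 k3 = l.
Proof.
  intros (f2 & f1 & H3 & H2 & H1). unfold fourier_coeff.
  assert (E2 : forall t1, C_RInt (fun t2 => C_RInt (fun t3 =>
    f (cis t1) (cis t2) (cis t3) * cis (- (IZR k1 * t1 + IZR k2 * t2 + IZR k3 * t3)))%C
    0 (2 * PI)) 0 (2 * PI) = (RtoC (2 * PI) * (RtoC (2 * PI) * f1 t1))%C).
  { intros t1. apply is_mean_unique.
    apply (is_mean_ext (fun t2 => RtoC (2 * PI) * f2 t1 t2)%C).
    - intros t2. symmetry. apply is_mean_unique, H3.
    - apply is_mean_scal, H2. }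
  rewrite (is_mean_unique _ (RtoC (2 * PI) * (RtoC (2 * PI) * l))%C).
  - pose proof PI_RGT_0. rewrite RtoC_inv, RtoC_pow by (apply pow_nonzero; lra).
    field. apply two_PI_neq_0.
  - apply (is_mean_ext (fun t1 => RtoC (2 * PI) * (RtoC (2 * PI) * f1 t1))%C).
    + intros t1. now rewrite E2.
    + apply is_mean_scal, is_mean_scal, H1.
Qed.

(** * Moments of a sum of three unimodular numbers *)
(** Kronecker's symbol. *)
Definition delta (p q : nat) : C := if Nat.eqb p q then RtoC 1 else RtoC 0.

Lemma Csum_scal_l (c : C) (u : nat -> C) (n : nat) :
  (c * sum_n u n)%C = sum_n (fun k => c * u k)%C n.
Proof. symmetry. exact (sum_n_mult_l (K := C_Ring) c u n). Qed.

Lemma Csum_scal_r (c : C) (u : nat -> C) (n : nat) :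
  (sum_n u n * c)%C = sum_n (fun k => u k * c)%C n.
Proof. symmetry. exact (sum_n_mult_r (K := C_Ring) c u n). Qed.

Lemma Csum_delta (u : nat -> C) (n k : nat) :
  (k <= n)%nat -> sum_n (fun i => u i * delta i k)%C n = u k.
Proof.
  intros Hk.
  assert (Hz : forall m, (m < k)%nat -> sum_n (fun i => u i * delta i k)%C m = RtoC 0).
  { induction m as [|m IH]; intros Hm.
    - rewrite sum_O. unfold delta. destruct (Nat.eqb_spec 0 k); [lia|]. in_C. ring.
    - rewrite sum_Sn, IH by lia. unfold delta.
      destruct (Nat.eqb_spec (S m) k); [lia|]. in_C. ring. }
  induction Hk as [|n Hk IH].
  - destruct k as [|k].
    + rewrite sum_O. unfold delta. simpl. in_C. ring.
    + rewrite sum_Sn, Hz by lia. unfold delta. rewrite Nat.eqb_refl. in_C. ring.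
  - rewrite sum_Sn, IH. unfold delta.
    destruct (Nat.eqb_spec (S n) k); [lia|]. in_C. ring.
Qed.

Lemma RtoC_sum (u : nat -> R) (n : nat) :
  RtoC (sum_n u n) = sum_n (fun k => RtoC (u k)) n.
Proof.
  induction n as [|n IH]; [now rewrite !sum_O|].
  rewrite !sum_Sn, <- IH. apply RtoC_plus.
Qed.

Lemma cis_conj (t : R) : Cconj (cis t) = cis (- t).
Proof. unfold cis, Cconj. simpl. now rewrite cos_neg, sin_neg. Qed.

Lemma cis_plus (s t : R) : cis (s + t) = (cis s * cis t)%C.
Proof.
  unfold cis, Cmult. simpl. rewrite cos_plus, sin_plus. f_equal; ring.
Qed.

Lemma cis_0 : cis 0 = RtoC 1.
Proof. unfold cis. now rewrite cos_0, sin_0. Qed.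

Lemma cis_pow (t : R) (n : nat) : (cis t ^ n)%C = cis (INR n * t).
Proof.
  induction n as [|n IH].
  - simpl. now rewrite Rmult_0_l, cis_0.
  - rewrite Cpow_S, IH, <- cis_plus, S_INR. f_equal. ring.
Qed.

Lemma Cmod_cis (t : R) : Cmod (cis t) = 1.
Proof.
  unfold Cmod, cis. simpl fst; simpl snd.
  rewrite <- sqrt_1. f_equal.
  pose proof (sin2_cos2 t). unfold Rsqr in *. lra.
Qed.

Lemma sin_cos_2PI_Z (k : Z) : sin (IZR k * (2 * PI)) = 0 /\ cos (IZR k * (2 * PI)) = 1.
Proof.
  assert (HN : forall n, sin (INR n * (2 * PI)) = 0 /\ cos (INR n * (2 * PI)) = 1).
  { intros n. split.
    - rewrite <- sin_0, <- (sin_period 0 n). f_equal. ring.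
    - rewrite <- cos_0, <- (cos_period 0 n). f_equal. ring. }
  destruct (Z_le_gt_dec 0 k) as [Hk|Hk].
  - rewrite <- (Z2Nat.id k) by lia. rewrite <- INR_IZR_INZ. apply HN.
  - replace (IZR k * (2 * PI)) with (- (IZR (- k) * (2 * PI)))
      by (rewrite opp_IZR; ring).
    rewrite sin_neg, cos_neg.
    rewrite <- (Z2Nat.id (- k)) by lia. rewrite <- INR_IZR_INZ.
    destruct (HN (Z.to_nat (- k))). split; lra.
Qed.

Lemma is_mean_cis (k : Z) :
  is_mean (fun t => cis (IZR k * t)) (if Z.eqb k 0 then RtoC 1 else RtoC 0).
Proof.
  destruct (Z.eqb_spec k 0) as [->|Hk].
  - apply (is_mean_ext (fun _ => RtoC 1)).
    { intros t. now rewrite Rmult_0_l, cis_0. }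
    unfold is_mean.
    replace (RtoC (2 * PI) * RtoC 1)%C
      with (scal (V := C_R_NormedModule) (2 * PI - 0) (RtoC 1)).
    + apply (is_RInt_const (V := C_R_NormedModule)).
    + apply injective_projections; simpl; unfold scal; simpl; unfold mult; simpl; ring.
  - assert (Hk' : IZR k <> 0) by (now apply not_0_IZR).
    destruct (sin_cos_2PI_Z k) as [Hs Hc].
    unfold is_mean. rewrite Cmult_0_r.
    apply (is_RInt_fct_extend_pair (U := R_NormedModule) (V := R_NormedModule)).
    + replace 0 with (minus (sin (IZR k * (2 * PI)) / IZR k) (sin (IZR k * 0) / IZR k)) at 2.
      2:{ rewrite Hs, Rmult_0_r, sin_0. unfold minus, plus, opp; simpl. field. exact Hk'. }
      apply (is_RInt_derive (V := R_CompleteNormedModule) (fun t => sin (IZR k * t) / IZR k)).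
      * intros t _. auto_derive; [trivial|]. simpl. field. exact Hk'.
      * intros t _. apply (ex_derive_continuous (V := R_NormedModule)).
        unfold cis; simpl. auto_derive. trivial.
    + replace 0 with (minus (- cos (IZR k * (2 * PI)) / IZR k) (- cos (IZR k * 0) / IZR k)) at 2.
      2:{ rewrite Hc, Rmult_0_r, cos_0. unfold minus, plus, opp; simpl. field. exact Hk'. }
      apply (is_RInt_derive (V := R_CompleteNormedModule) (fun t => - cos (IZR k * t) / IZR k)).
      * intros t _. auto_derive; [trivial|]. simpl. field. exact Hk'.
      * intros t _. apply (ex_derive_continuous (V := R_NormedModule)).
        unfold cis; simpl. auto_derive. trivial.
Qed.

Lemma is_mean_monomial (p q : nat) :
  is_mean (fun t => cis t ^ p * Cconj (cis t) ^ q)%C (delta p q).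
Proof.
  replace (delta p q) with (if Z.eqb (Z.of_nat p - Z.of_nat q) 0 then RtoC 1 else RtoC 0).
  - apply (is_mean_ext (fun t => cis (IZR (Z.of_nat p - Z.of_nat q) * t))); [|apply is_mean_cis].
    intros t. rewrite cis_conj, !cis_pow, <- cis_plus, minus_IZR, <- !INR_IZR_INZ.
    f_equal. ring.
  - unfold delta. destruct (Z.eqb_spec (Z.of_nat p - Z.of_nat q) 0),
      (Nat.eqb_spec p q); (reflexivity || lia).
Qed.

(** Orthogonality of the powers of [z] on the unit circle. *)
Lemma is_mean_parseval (u v : nat -> C) (n : nat) :
  is_mean (fun t => sum_n (fun i => u i * cis t ^ i) n
                    * sum_n (fun j => v j * Cconj (cis t) ^ j) n)%C
    (sum_n (fun i => u i * v i)%C n).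
Proof.
  apply (is_mean_ext (fun t => sum_n (fun j => sum_n (fun i =>
    u i * v j * (cis t ^ i * Cconj (cis t) ^ j))%C n) n)).
  { intros t. rewrite Csum_scal_l. apply sum_n_ext. intros j.
    rewrite Csum_scal_r. apply sum_n_ext. intros i. in_C. ring. }
  rewrite (sum_n_ext_loc (fun i => u i * v i)%C
    (fun j => sum_n (fun i => u i * v j * delta i j)%C n)).
  2:{ intros j Hj. symmetry. exact (Csum_delta (fun i => u i * v j)%C n j Hj). }
  apply is_mean_sum. intros j. apply is_mean_sum. intros i.
  apply is_mean_scal, is_mean_monomial.
Qed.

(** The binomial theorem; the terms with [n < j] vanish. *)
Lemma C_binomial (x y : C) (n N : nat) :
  (n <= N)%nat ->
  ((x + y) ^ n)%C = sum_n (fun j => RtoC (binom n j) * x ^ (n - j) * y ^ j)%C N.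
Proof.
  revert N; induction n as [|n IH]; intros N HN.
  - rewrite (sum_n_ext _ (fun j => (RtoC 1) * delta j 0)%C).
    + rewrite (Csum_delta (fun _ => RtoC 1)) by lia. reflexivity.
    + intros [|j]; unfold delta; simpl Nat.eqb; cbv iota.
      * rewrite binom_0_r. simpl. in_C. ring.
      * rewrite binom_0_S. in_C. ring.
  - destruct N as [|N]; [lia|].
    rewrite Cpow_S, Cmult_plus_distr_r.
    rewrite (IH (S N)) at 1 by lia. rewrite (IH N) by lia.
    rewrite !Csum_scal_l.
    unfold sum_n. rewrite !(sum_Sn_m _ 0 (S N)) by lia. rewrite <- !sum_n_m_S.
    rewrite !binom_0_r.
    assert (E : forall a b c d e : C, a = d -> (b + c = e)%C ->
      ((a + b) + c = d + e)%C).
    { intros a b c d e -> <-. ring. }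
    apply E.
    + rewrite !Nat.sub_0_r, Cpow_S. ring.
    + change (@eq C (plus
        (sum_n (fun k => x * (RtoC (binom n (S k)) * x ^ (n - S k) * y ^ S k))%C N)
        (sum_n (fun k => y * (RtoC (binom n k) * x ^ (n - k) * y ^ k))%C N))
        (sum_n (fun k => RtoC (binom (S n) (S k)) * x ^ (S n - S k) * y ^ S k)%C N)).
      rewrite <- sum_n_plus. apply sum_n_ext. intros k. in_C.
      rewrite binom_pascal, RtoC_plus. simpl Nat.sub. rewrite Cpow_S.
      destruct (Nat.le_gt_cases n k) as [Hk|Hk].
      * rewrite (binom_small n (S k)) by lia. ring.
      * replace (n - k)%nat with (S (n - S k)) by lia. rewrite Cpow_S. ring.
Qed.

Lemma is_mean_binomial (A : C) (n m N : nat) :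
  (n <= N)%nat -> (m <= N)%nat ->
  is_mean (fun t => (A + cis t) ^ n * Cconj (A + cis t) ^ m)%C
    (sum_n (fun j => RtoC (binom n j * binom m j)
                     * (A ^ (n - j) * Cconj A ^ (m - j)))%C N).
Proof.
  intros Hn Hm.
  apply (is_mean_ext (fun t =>
    sum_n (fun i => (RtoC (binom n i) * A ^ (n - i)) * cis t ^ i) N
    * sum_n (fun j => (RtoC (binom m j) * Cconj A ^ (m - j)) * Cconj (cis t) ^ j) N)%C).
  { intros t. rewrite Cplus_conj, (C_binomial _ _ n N Hn), (C_binomial _ _ m N Hm).
    reflexivity. }
  rewrite (sum_n_ext _ (fun j => (RtoC (binom n j) * A ^ (n - j))
    * (RtoC (binom m j) * Cconj A ^ (m - j)))%C).
  2:{ intros j. rewrite RtoC_mult. in_C. ring. }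
  apply is_mean_parseval.
Qed.

(** By rotation, [s^n conj(s)^m conj(z1)^e] with [s = z1 + z2 + z3] has mean [0] unless
    [n = m + e]. *)
Lemma is_mean3_monomial (n m e N : nat) :
  (n <= N)%nat -> (m <= N)%nat ->
  is_mean3 (fun t1 t2 t3 =>
      (cis t1 + cis t2 + cis t3) ^ n * Cconj (cis t1 + cis t2 + cis t3) ^ m
      * Cconj (cis t1) ^ e)%C
    (RtoC (moment3_pair n m N) * delta n (m + e))%C.
Proof.
  intros Hn Hm.
  exists (fun t1 t2 => Cconj (cis t1) ^ e *
    sum_n (fun j => RtoC (binom n j * binom m j)
      * ((cis t1 + cis t2) ^ (n - j) * Cconj (cis t1 + cis t2) ^ (m - j))) N)%C.
  exists (fun t1 => Cconj (cis t1) ^ e *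
    sum_n (fun j => RtoC (binom n j * binom m j) *
      sum_n (fun k => RtoC (binom (n - j) k * binom (m - j) k)
        * (cis t1 ^ (n - j - k) * Cconj (cis t1) ^ (m - j - k))) N) N)%C.
  repeat split.
  - intros t1 t2.
    apply (is_mean_ext (fun t => Cconj (cis t1) ^ e *
      (((cis t1 + cis t2) + cis t) ^ n * Cconj ((cis t1 + cis t2) + cis t) ^ m))%C).
    { intros t. ring. }
    apply is_mean_scal, is_mean_binomial; assumption.
  - intros t1. apply is_mean_scal, is_mean_sum. intros j.
    apply is_mean_scal, is_mean_binomial; lia.
  - apply (is_mean_ext (fun t => sum_n (fun j => sum_n (fun k =>
      RtoC ((binom n j * binom (n - j) k) * (binom m j * binom (m - j) k))
      * (cis t ^ (n - j - k) * Cconj (cis t) ^ (m - j - k + e)))%C N) N)).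
    { intros t. rewrite Csum_scal_l. apply sum_n_ext. intros j.
      rewrite !Csum_scal_l. apply sum_n_ext. intros k.
      rewrite Cpow_add_r, !RtoC_mult. in_C. ring. }
    unfold moment3_pair. rewrite RtoC_sum, Csum_scal_r.
    apply is_mean_sum. intros j. rewrite RtoC_sum, Csum_scal_r.
    apply is_mean_sum. intros k.
    replace (RtoC (binom n j * binom (n - j) k * (binom m j * binom (m - j) k))
             * delta n (m + e))%C
      with (RtoC (binom n j * binom (n - j) k * (binom m j * binom (m - j) k))
             * delta (n - j - k) (m - j - k + e))%C.
    + apply is_mean_scal, is_mean_monomial.
    + destruct (Nat.lt_ge_cases n (j + k)) as [H|H].
      { replace (binom n j * binom (n - j) k) with 0; [rewrite Rmult_0_l; ring|].
        destruct (Nat.lt_ge_cases n j).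
        - rewrite (binom_small n j) by lia. ring.
        - rewrite (binom_small (n - j) k) by lia. ring. }
      destruct (Nat.lt_ge_cases m (j + k)) as [H'|H'].
      { replace (binom m j * binom (m - j) k) with 0; [rewrite Rmult_0_r; ring|].
        destruct (Nat.lt_ge_cases m j).
        - rewrite (binom_small m j) by lia. ring.
        - rewrite (binom_small (m - j) k) by lia. ring. }
      f_equal. unfold delta.
      destruct (Nat.eqb_spec (n - j - k) (m - j - k + e)),
        (Nat.eqb_spec n (m + e)); (reflexivity || lia).
Qed.

(** * Fourier coefficients of [1 / |p|^2] *)
Lemma moment3_le (n : nat) : moment3 n <= 9 ^ n.
Proof.
  induction n as [|n IH].
  - rewrite moment3_0. simpl. lra.
  - pose proof (moment3_growth n). simpl. lra.
Qed.

(** Bounded terms at [r] bound the radius of convergence from below. *)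
Lemma CV_radius_ge (u : nat -> R) (M r : R) :
  (forall n, Rabs (u n * r ^ n) <= M) -> Rbar_le r (CV_radius u).
Proof.
  intros H. apply (proj1 (CV_radius_bounded u)). exists M. exact H.
Qed.

Lemma CV_radius_moment3 : Rbar_le (1 / 9) (CV_radius moment3).
Proof.
  apply (CV_radius_ge _ 1). intros n.
  pose proof (moment3_ge_1 n). pose proof (moment3_le n).
  assert (0 < 9 ^ n) by (apply pow_lt; lra).
  replace (1 / 9) with (/ 9) by field. rewrite pow_inv.
  rewrite Rabs_pos_eq.
  - apply Rmult_le_reg_r with (9 ^ n); [lra|]. rewrite Rmult_assoc, Rinv_l; lra.
  - apply Rmult_le_pos; [lra|]. left. now apply Rinv_0_lt_compat.
Qed.

Lemma CV_radius_moment3_succ : Rbar_le (1 / 9) (CV_radius (fun n => moment3 (S n))).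
Proof.
  change (fun n => moment3 (S n)) with (PS_decr_1 moment3).
  rewrite CV_radius_decr_1. apply CV_radius_moment3.
Qed.

Lemma is_lim_partial_sums (u : nat -> R) (x : R) :
  Rbar_lt (Rabs x) (CV_radius u) ->
  is_lim_seq (fun n => sum_n (fun k => u k * x ^ k) n) (PSeries u x).
Proof.
  intros H.
  assert (E : ex_pseries u x).
  { apply CV_disk_correct, CV_disk_inside, H. }
  pose proof (PSeries_correct u x E) as Hs.
  unfold is_pseries, is_series in Hs.
  apply (is_lim_seq_ext (sum_n (fun k => scal (pow_n x k) (u k)))); [|exact Hs].
  intros n. apply sum_n_ext. intros k. unfold scal; simpl. unfold mult; simpl.
  rewrite pow_n_pow. ring.
Qed.

Lemma geom_sum_C (r : C) (n : nat) :
  ((RtoC 1 - r) * sum_n (fun k => r ^ k)%C n)%C = (RtoC 1 - r ^ (S n))%C.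
Proof.
  induction n as [|n IH].
  - rewrite sum_O. simpl. ring.
  - rewrite sum_Sn. change (@plus C_AbelianMonoid) with Cplus.
    rewrite Cmult_plus_distr_l, IH. rewrite !Cpow_S. ring.
Qed.

Lemma geom_tail_C (r : C) (q : R) (n : nat) :
  Cmod r <= q -> q < 1 ->
  (RtoC 1 - r)%C <> RtoC 0 /\ Cmod (/ (RtoC 1 - r))%C <= / (1 - q) /\
  Cmod (sum_n (fun k => r ^ k) n - / (RtoC 1 - r))%C <= q ^ S n / (1 - q).
Proof.
  intros Hr Hq.
  assert (H1 : 1 - q <= Cmod (RtoC 1 - r)).
  { pose proof (Cmod_triangle (RtoC 1 - r) r) as H.
    replace (RtoC 1 - r + r)%C with (RtoC 1) in H by ring.
    rewrite Cmod_1 in H. lra. }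
  assert (H2 : (RtoC 1 - r)%C <> RtoC 0).
  { apply Cmod_gt_0. lra. }
  assert (H3 : Cmod (/ (RtoC 1 - r))%C <= / (1 - q)).
  { rewrite Cmod_inv by exact H2. apply Rinv_le_contravar; lra. }
  split; [exact H2|split; [exact H3|]].
  replace (sum_n (fun k => r ^ k) n - / (RtoC 1 - r))%C
    with (- (r ^ S n * / (RtoC 1 - r)))%C.
  2:{ pose proof (geom_sum_C r n) as E.
      replace (r ^ S n)%C with (RtoC 1 - (RtoC 1 - r) * sum_n (fun k => r ^ k) n)%C
        by (rewrite E; ring).
      field. exact H2. }
  rewrite Cmod_opp, Cmod_mult. unfold Rdiv.
  apply Rmult_le_compat; try apply Cmod_ge_0; [|exact H3].
  rewrite Cmod_pow. apply pow_incr. split; [apply Cmod_ge_0|exact Hr].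
Qed.

Lemma Cmod_cis_sum (t1 t2 t3 : R) : Cmod (cis t1 + cis t2 + cis t3) <= 3.
Proof.
  pose proof (Cmod_triangle (cis t1 + cis t2) (cis t3)).
  pose proof (Cmod_triangle (cis t1) (cis t2)).
  rewrite !Cmod_cis in *. lra.
Qed.

(** The error made in replacing [|h|^2 c] by [u conj(v) c], where [u] and [v]
    approximate [h]. *)
Lemma truncation_error (h u v c : C) (q e : R) :
  0 <= q <= 1 -> Cmod c = 1 -> Cmod h <= e ->
  Cmod (u - h) <= q * e -> Cmod (v - h) <= q * e ->
  Cmod (u * Cconj v * c - h * Cconj h * c) <= 3 * e ^ 2 * q.
Proof.
  intros Hq Hc Hh Hu Hv.
  replace (u * Cconj v * c - h * Cconj h * c)%C
    with (((u - h) * Cconj v + h * Cconj (v - h)) * c)%C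
    by (rewrite Cminus_conj; ring).
  rewrite Cmod_mult, Hc, Rmult_1_r.
  eapply Rle_trans; [apply Cmod_triangle|].
  rewrite !Cmod_mult, !Cmod_conj.
  assert (He : 0 <= e) by (pose proof (Cmod_ge_0 h); lra).
  assert (Hqe : q * e <= e) by nra.
  assert (Hv' : Cmod v <= 2 * e).
  { pose proof (Cmod_triangle (v - h) h) as H.
    replace (v - h + h)%C with v in H by ring. nra. }
  pose proof (Cmod_ge_0 h). pose proof (Cmod_ge_0 v).
  pose proof (Cmod_ge_0 (u - h)). pose proof (Cmod_ge_0 (v - h)).
  assert (Cmod (u - h) * Cmod v <= (q * e) * (2 * e)) by (apply Rmult_le_compat; lra).
  assert (Cmod h * Cmod (v - h) <= e * (q * e)) by (apply Rmult_le_compat; lra).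
  lra.
Qed.

(** The mean of [conj(z1)^e / |1 + w (z1 + z2 + z3)|^2], from the geometric series of
    [h = 1 / (1 + w (z1 + z2 + z3))].  The first factor is truncated [e] terms later
    than its conjugate, so that the pairs [n = m + e] with [m <= N] all occur. *)
Lemma is_mean3_inv_sqmod (w : C) (e : nat) (L : R) :
  Cmod w < 1 / 3 ->
  is_lim_seq (fun N => sum_n (fun m => moment3_pair (m + e) m (m + e) * (Cmod w ^ 2) ^ m) N) L ->
  is_mean3 (fun t1 t2 t3 => inv_sqmod (RtoC 1) w (cis t1) (cis t2) (cis t3)
      * Cconj (cis t1) ^ e)%C ((- w) ^ e * RtoC L)%C.
Proof.
  intros Hw HL.
  set (q := 3 * Cmod w).
  assert (Hq : 0 <= q < 1) by (unfold q; pose proof (Cmod_ge_0 w); lra).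
  set (s := fun t1 t2 t3 => (cis t1 + cis t2 + cis t3)%C).
  set (h := fun N t1 t2 t3 => sum_n (fun n => (- w * s t1 t2 t3) ^ n)%C N).
  set (l := fun N => sum_n (fun m => (- w) ^ (m + e) * Cconj (- w) ^ m
                      * RtoC (moment3_pair (m + e) m (m + e)))%C N).
  destruct (is_mean3_lim
    (fun N t1 t2 t3 => h (N + e)%nat t1 t2 t3 * Cconj (h N t1 t2 t3) * Cconj (cis t1) ^ e)%C
    (fun t1 t2 t3 => inv_sqmod (RtoC 1) w (cis t1) (cis t2) (cis t3)
      * Cconj (cis t1) ^ e)%C l
    (fun N => 3 * (/ (1 - q)) ^ 2 * q ^ S N)) as [l' [Hl' Hdist]].
  - intros N.
    apply (is_mean3_ext (fun t1 t2 t3 => sum_n (fun m => sum_n (fun n =>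
      ((- w) ^ n * Cconj (- w) ^ m) * (s t1 t2 t3 ^ n * Cconj (s t1 t2 t3) ^ m
      * Cconj (cis t1) ^ e))%C (N + e)) N)).
    { intros t1 t2 t3. unfold h.
      assert (Econj : forall (u : nat -> C) n, Cconj (sum_n u n) = sum_n (fun k => Cconj (u k)) n).
      { intros u n; induction n as [|n IH]; [now rewrite !sum_O|].
        rewrite !sum_Sn, <- IH. apply Cplus_conj. }
      rewrite Econj, Csum_scal_l, Csum_scal_r. apply sum_n_ext. intros m.
      rewrite !Csum_scal_r. apply sum_n_ext. intros n.
      rewrite Cpow_conj, Cmult_conj, !Cpow_mult_l. in_C. ring. }
    unfold l. rewrite (sum_n_ext_loc _ (fun m => sum_n (fun n =>
      ((- w) ^ n * Cconj (- w) ^ m) * (RtoC (moment3_pair n m (Nat.max n m)) * delta n (m + e)))%C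
       (N + e))).
    + apply is_mean3_sum. intros m. apply is_mean3_sum. intros n.
      apply is_mean3_scal. unfold s. apply is_mean3_monomial; lia.
    + intros m Hm. symmetry.
      rewrite (sum_n_ext _ (fun n => ((- w) ^ n * Cconj (- w) ^ m
        * RtoC (moment3_pair n m (Nat.max n m))) * delta n (m + e))%C)
        by (intros n; in_C; ring).
      rewrite (Csum_delta (fun n => (- w) ^ n * Cconj (- w) ^ m
        * RtoC (moment3_pair n m (Nat.max n m)))%C) by lia.
      rewrite Nat.max_l by lia. reflexivity.
  - intros N t1 t2 t3.
    assert (Hr : Cmod (- w * s t1 t2 t3) <= q).
    { rewrite Cmod_mult, Cmod_opp. unfold q, s. pose proof (Cmod_cis_sum t1 t2 t3).
      pose proof (Cmod_ge_0 w). nra. }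
    destruct (geom_tail_C _ q N Hr (proj2 Hq)) as (Hnz & Hh & HN).
    destruct (geom_tail_C _ q (N + e) Hr (proj2 Hq)) as (_ & _ & HNe).
    set (hh := (/ (RtoC 1 - - w * s t1 t2 t3))%C) in *.
    replace (inv_sqmod (RtoC 1) w (cis t1) (cis t2) (cis t3)) with (hh * Cconj hh)%C.
    2:{ unfold inv_sqmod, sympoly, hh. fold (s t1 t2 t3).
        replace (RtoC 1 + w * s t1 t2 t3)%C with (RtoC 1 - - w * s t1 t2 t3)%C by ring.
        rewrite <- Cmod2_conj, Cmod_inv by exact Hnz.
        now rewrite pow_inv. }
    assert (Hqn : 0 <= q ^ S N <= 1).
    { split; [apply pow_le; lra|]. rewrite <- (pow1 (S N)). apply pow_incr; lra. }
    apply truncation_error.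
    + exact Hqn.
    + rewrite Cmod_pow, Cmod_conj, Cmod_cis. apply pow1.
    + exact Hh.
    + eapply Rle_trans; [exact HNe|]. unfold Rdiv. apply Rmult_le_compat_r.
      * left. apply Rinv_0_lt_compat. lra.
      * replace (S (N + e)) with (S N + e)%nat by lia. rewrite pow_add.
        assert (q ^ e <= 1) by (rewrite <- (pow1 e); apply pow_incr; lra). nra.
    + exact HN.
  - replace 0 with (3 * (/ (1 - q)) ^ 2 * 0) by ring.
    apply (is_lim_seq_scal_l _ _ 0).
    apply (is_lim_seq_incr_1 (fun n => q ^ n)). apply is_lim_seq_geom.
    rewrite Rabs_pos_eq; lra.
  - replace ((- w) ^ e * RtoC L)%C with l'; [exact Hl'|].
    set (S1 := fun N => sum_n (fun m => moment3_pair (m + e) m (m + e) * (Cmod w ^ 2) ^ m) N) in *.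
    assert (El : forall N, l N = ((- w) ^ e * RtoC (S1 N))%C).
    { intros N. unfold l, S1. rewrite RtoC_sum, Csum_scal_l. apply sum_n_ext. intros m.
      rewrite Cpow_add_r, RtoC_mult, RtoC_pow, <- (Cmod_opp w), Cmod2_conj, Cpow_mult_l.
      in_C. ring. }
    assert (Hlim : is_lim_seq (fun N => 3 * (/ (1 - q)) ^ 2 * q ^ S N
       + Cmod ((- w) ^ e) * Rabs (S1 N - L)) 0).
    { replace 0 with (3 * (/ (1 - q)) ^ 2 * 0 + Cmod ((- w) ^ e) * 0) by ring.
      apply is_lim_seq_plus'.
      - apply (is_lim_seq_scal_l _ _ 0).
        apply (is_lim_seq_incr_1 (fun n => q ^ n)). apply is_lim_seq_geom.
        rewrite Rabs_pos_eq; lra.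
      - apply (is_lim_seq_scal_l _ _ 0).
        apply (proj1 (is_lim_seq_abs_0 (fun N => S1 N - L))).
        replace 0 with (L - L) by ring. apply is_lim_seq_minus'; [exact HL|].
        apply is_lim_seq_const. }
    assert (H0 : Cmod (l' - (- w) ^ e * RtoC L) <= 0).
    { refine (is_lim_seq_le _ _ (Cmod (l' - (- w) ^ e * RtoC L)) 0 _
        (is_lim_seq_const _) Hlim).
      intros N. specialize (Hdist N). rewrite El in Hdist.
      replace (l' - (- w) ^ e * RtoC L)%C with
        (- ((- w) ^ e * RtoC (S1 N) - l') + (- w) ^ e * RtoC (S1 N - L))%C
        by (rewrite RtoC_minus; ring).
      eapply Rle_trans; [apply Cmod_triangle|].
      rewrite Cmod_opp, (Cmod_mult _ (RtoC (S1 N - L))), Cmod_R. lra. }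
    assert (H1 : (l' - (- w) ^ e * RtoC L)%C = RtoC 0).
    { apply Cmod_eq_0. pose proof (Cmod_ge_0 (l' - (- w) ^ e * RtoC L)). lra. }
    replace l' with ((l' - (- w) ^ e * RtoC L) + (- w) ^ e * RtoC L)%C by ring.
    rewrite H1. ring.
Qed.

Lemma moment3_pair_diag (n : nat) : moment3_pair n n n = moment3 n.
Proof.
  unfold moment3_pair, moment3. apply sum_n_ext; intros j. apply sum_n_ext; intros k.
  in_R. ring.
Qed.

Lemma moment3_pair_succ (n : nat) : moment3_pair (S n) n (S n) = moment3 (S n) / 3.
Proof. rewrite <- moment3_pair_succ_thrice. unfold Rdiv.
  rewrite Rmult_comm, <- Rmult_assoc, Rinv_l, Rmult_1_l by lra. reflexivity.
Qed.

Lemma dominant_p0_neq_0 (p0 p1 : C) (dominant : 3 * Cmod p1 < Cmod p0) :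
  p0 <> RtoC 0.
Proof. apply Cmod_gt_0. pose proof (Cmod_ge_0 p1). lra. Qed.

Lemma dominant_ratio (p0 p1 : C) (dominant : 3 * Cmod p1 < Cmod p0) :
  0 <= Cmod (p1 / p0) < 1 / 3.
Proof.
  split; [apply Cmod_ge_0|].
  rewrite Cmod_div by apply (dominant_p0_neq_0 p0 p1 dominant).
  pose proof (Cmod_ge_0 p1).
  apply Rmult_lt_reg_r with (Cmod p0); [lra|]. unfold Rdiv. rewrite Rmult_assoc, Rinv_l; lra.
Qed.

Lemma dominant_ratio_sq (p0 p1 : C) (dominant : 3 * Cmod p1 < Cmod p0) :
  Rabs (Cmod (p1 / p0) ^ 2) < 1 / 9.
Proof. pose proof (dominant_ratio p0 p1 dominant). rewrite Rabs_pos_eq; nra. Qed.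

Lemma inv_sqmod_normalize (p0 p1 : C) (dominant : 3 * Cmod p1 < Cmod p0)
    (z1 z2 z3 : C) :
  inv_sqmod p0 p1 z1 z2 z3
  = (RtoC (/ Cmod p0 ^ 2) * inv_sqmod (RtoC 1) (p1 / p0) z1 z2 z3)%C.
Proof.
  unfold inv_sqmod. rewrite <- RtoC_mult. f_equal.
  rewrite <- Rinv_mult, <- Rpow_mult_distr, <- Cmod_mult. do 3 f_equal.
  unfold sympoly. field. apply (dominant_p0_neq_0 p0 p1 dominant).
Qed.

Lemma fourier_coeff_000 (p0 p1 : C) (dominant : 3 * Cmod p1 < Cmod p0) :

  fourier_coeff (inv_sqmod p0 p1) 0 0 0
  = RtoC (PSeries moment3 (Cmod (p1 / p0) ^ 2) / Cmod p0 ^ 2).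
Proof.
  apply is_mean3_fourier.
  apply (is_mean3_ext (fun t1 t2 t3 => RtoC (/ Cmod p0 ^ 2) *
    (inv_sqmod (RtoC 1) (p1 / p0) (cis t1) (cis t2) (cis t3) * Cconj (cis t1) ^ 0))%C).
  { intros t1 t2 t3. rewrite (inv_sqmod_normalize p0 p1 dominant).
    replace (- (0 * t1 + 0 * t2 + 0 * t3)) with 0 by ring. rewrite cis_0. simpl. ring. }
  replace (RtoC (PSeries moment3 (Cmod (p1 / p0) ^ 2) / Cmod p0 ^ 2)) with
    (RtoC (/ Cmod p0 ^ 2) * ((- (p1 / p0)) ^ 0 * RtoC (PSeries moment3 (Cmod (p1 / p0) ^ 2))))%C.
  2:{ unfold Rdiv. rewrite RtoC_mult. simpl Cpow. ring. }
  apply is_mean3_scal, is_mean3_inv_sqmod; [apply (dominant_ratio p0 p1 dominant)|].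
  apply (is_lim_seq_ext (fun N => sum_n (fun k => moment3 k * (Cmod (p1 / p0) ^ 2) ^ k) N)).
  { intros N. apply sum_n_ext. intros m. now rewrite Nat.add_0_r, moment3_pair_diag. }
  apply is_lim_partial_sums.
  eapply Rbar_lt_le_trans; [|apply CV_radius_moment3]. apply (dominant_ratio_sq p0 p1 dominant).
Qed.

Lemma fourier_coeff_100 (p0 p1 : C) (dominant : 3 * Cmod p1 < Cmod p0) :

  fourier_coeff (inv_sqmod p0 p1) 1 0 0
  = (- (p1 / p0) * RtoC (PSeries (fun n => moment3 (S n)) (Cmod (p1 / p0) ^ 2)
                        / (3 * Cmod p0 ^ 2)))%C.
Proof.
  apply is_mean3_fourier.
  apply (is_mean3_ext (fun t1 t2 t3 => RtoC (/ Cmod p0 ^ 2) *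
    (inv_sqmod (RtoC 1) (p1 / p0) (cis t1) (cis t2) (cis t3) * Cconj (cis t1) ^ 1))%C).
  { intros t1 t2 t3. rewrite (inv_sqmod_normalize p0 p1 dominant).
    replace (- (1 * t1 + 0 * t2 + 0 * t3)) with (- t1) by ring. rewrite cis_conj. simpl. ring. }
  set (x := Cmod (p1 / p0) ^ 2).
  replace (- (p1 / p0) * RtoC (PSeries (fun n => moment3 (S n)) x / (3 * Cmod p0 ^ 2)))%C with
    (RtoC (/ Cmod p0 ^ 2) * ((- (p1 / p0)) ^ 1
      * RtoC (1 / 3 * PSeries (fun n => moment3 (S n)) x)))%C.
  2:{ rewrite Cpow_1_r.
      replace (PSeries (fun n => moment3 (S n)) x / (3 * Cmod p0 ^ 2))
        with (/ Cmod p0 ^ 2 * (1 / 3 * PSeries (fun n => moment3 (S n)) x)).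
      - rewrite (RtoC_mult (/ _)). ring.
      - field. apply Rgt_not_eq, Cmod_gt_0, (dominant_p0_neq_0 p0 p1 dominant). }
  apply is_mean3_scal, is_mean3_inv_sqmod; [apply (dominant_ratio p0 p1 dominant)|].
  apply (is_lim_seq_ext (fun N => 1 / 3 * sum_n (fun k => moment3 (S k) * x ^ k) N)).
  { intros N. rewrite <- (sum_n_mult_l (K := R_Ring)). apply sum_n_ext. intros m.
    rewrite Nat.add_1_r, moment3_pair_succ. unfold x. in_R. field. }
  apply (is_lim_seq_scal_l _ _ (PSeries (fun n => moment3 (S n)) x)).
  apply is_lim_partial_sums.
  eapply Rbar_lt_le_trans; [|apply CV_radius_moment3_succ].
  apply (dominant_ratio_sq p0 p1 dominant).
Qed.

(** The polydisk condition is tested at [z1 = z2 = z3 = - p0 / (3 p1)]. *)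
Lemma stable_dominant (p0 p1 : C) : stable p0 p1 <-> 3 * Cmod p1 < Cmod p0.
Proof.
  split.
  - intros H. destruct (Rle_lt_dec (Cmod p0) (3 * Cmod p1)) as [Hle|Hlt]; [|exact Hlt].
    exfalso. destruct (Ceq_dec p1 (RtoC 0)) as [->|Hp1].
    + apply (H (RtoC 0) (RtoC 0) (RtoC 0)); try (rewrite Cmod_0; lra).
      unfold sympoly. rewrite Cmod_0 in Hle.
      rewrite (Cmod_eq_0 p0); [ring|]. pose proof (Cmod_ge_0 p0). lra.
    + assert (Hpos : 0 < Cmod p1) by now apply Cmod_gt_0.
      assert (H3 : RtoC 3 <> RtoC 0) by (intros E; apply RtoC_inj in E; lra).
      assert (Hz : Cmod (- p0 / (RtoC 3 * p1)) <= 1).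
      { rewrite Cmod_div, Cmod_opp, Cmod_mult, Cmod_R, Rabs_pos_eq; try lra.
        - apply Rmult_le_reg_r with (3 * Cmod p1); [lra|].
          unfold Rdiv. rewrite Rmult_assoc, Rinv_l; lra.
        - now apply Cmult_neq_0. }
      apply (H _ _ _ Hz Hz Hz). unfold sympoly.
      assert (E3 : forall z : C, (z + z + z)%C = (RtoC 3 * z)%C).
      { intros z. apply injective_projections; simpl; ring. }
      rewrite E3. field. assumption.
  - intros H z1 z2 z3 H1 H2 H3 E. unfold sympoly in E.
    assert (E' : p0 = (- (p1 * (z1 + z2 + z3)))%C).
    { replace p0 with ((p0 + p1 * (z1 + z2 + z3)) - p1 * (z1 + z2 + z3))%C by ring.
      rewrite E. ring. }
    assert (Cmod p0 <= Cmod p1 * 3).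
    { rewrite E', Cmod_opp, Cmod_mult. apply Rmult_le_compat_l; [apply Cmod_ge_0|].
      pose proof (Cmod_triangle (z1 + z2) z3). pose proof (Cmod_triangle z1 z2). lra. }
    lra.
Qed.

(** * Power series and the Euler operator *)
(** Coefficients of [x f'(x)], for [f] with coefficients [u]. *)
Definition theta_coef (u : nat -> R) (n : nat) : R := INR n * u n.

(** Coefficients of [(x f'(x))']. *)
Definition theta_derive_coef (u : nat -> R) (n : nat) : R := INR (S n) ^ 2 * u (S n).

Lemma PSeries_theta (u : nat -> R) (x : R) :
  PSeries (theta_coef u) x = x * PSeries (PS_derive u) x.
Proof.
  rewrite <- PSeries_incr_1. apply PSeries_ext. intros [|n].
  - unfold theta_coef. simpl. change zero with 0. ring.
  - reflexivity.
Qed.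

Lemma CV_radius_theta (u : nat -> R) : CV_radius (theta_coef u) = CV_radius u.
Proof.
  rewrite <- (CV_radius_derive u), <- (CV_radius_incr_1 (PS_derive u)).
  apply CV_radius_ext. intros [|n].
  - unfold theta_coef. simpl. change zero with 0. ring.
  - reflexivity.
Qed.

Lemma PS_derive_theta (u : nat -> R) (n : nat) :
  PS_derive (theta_coef u) n = theta_derive_coef u n.
Proof. unfold PS_derive, theta_coef, theta_derive_coef. ring. Qed.

Lemma is_derive_PSeries_theta (u : nat -> R) (x : R) :
  Rbar_lt (Rabs x) (CV_radius u) ->
  is_derive (PSeries (theta_coef u)) x (PSeries (theta_derive_coef u) x).
Proof.
  intros H.
  rewrite <- (PSeries_ext _ _ x (PS_derive_theta u)).
  apply is_derive_PSeries. now rewrite CV_radius_theta.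
Qed.

Lemma is_pseries_theta_derive (u : nat -> R) (x : R) :
  Rbar_lt (Rabs x) (CV_radius u) ->
  is_pseries (theta_derive_coef u) x (PSeries (theta_derive_coef u) x).
Proof.
  intros H. apply PSeries_correct, CV_radius_inside.
  rewrite <- (CV_radius_ext _ _ (PS_derive_theta u)).
  now rewrite CV_radius_derive, CV_radius_theta.
Qed.

Lemma is_pseries_PSeries (u : nat -> R) (x : R) :
  Rbar_lt (Rabs x) (CV_radius u) -> is_pseries u x (PSeries u x).
Proof. intros H. now apply PSeries_correct, CV_radius_inside. Qed.

Lemma is_pseries_theta (u : nat -> R) (x : R) :
  Rbar_lt (Rabs x) (CV_radius u) ->
  is_pseries (theta_coef u) x (PSeries (theta_coef u) x).
Proof. intros H. apply is_pseries_PSeries. now rewrite CV_radius_theta. Qed.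

Lemma is_pseries_plus_R (u v : nat -> R) (x a b : R) :
  is_pseries u x a -> is_pseries v x b -> is_pseries (fun n => u n + v n) x (a + b).
Proof. exact (is_pseries_plus (V := R_NormedModule) u v x a b). Qed.

Lemma is_pseries_scal_R (c : R) (u : nat -> R) (x a : R) :
  is_pseries u x a -> is_pseries (fun n => c * u n) x (c * a).
Proof.
  apply (is_pseries_scal (V := R_NormedModule) c u x a), Rmult_comm.
Qed.

Lemma is_pseries_incr_R (u : nat -> R) (x a : R) :
  is_pseries u x a -> is_pseries (PS_incr_1 u) x (x * a).
Proof. exact (is_pseries_incr_1 (V := R_NormedModule) u x a). Qed.

Lemma PSeries_le (u v : nat -> R) (x : R) :
  0 <= x -> (forall n, 0 <= u n <= v n) -> Rbar_lt (Rabs x) (CV_radius v) ->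
  PSeries u x <= PSeries v x.
Proof.
  intros Hx Huv Hv. apply Series_le.
  - intros n. pose proof (pow_le x n Hx). destruct (Huv n). split.
    + now apply Rmult_le_pos.
    + now apply Rmult_le_compat_r.
  - apply ex_series_Rabs, CV_disk_inside, Hv.
Qed.

Lemma PSeries_ge_head (u : nat -> R) (x : R) :
  0 <= x -> (forall n, 0 <= u n) -> Rbar_lt (Rabs x) (CV_radius u) ->
  u 0%nat <= PSeries u x.
Proof.
  intros Hx Hu Hr.
  rewrite PSeries_decr_1 by now apply CV_radius_inside.
  assert (H : 0 <= PSeries (PS_decr_1 u) x).
  { replace 0 with (PSeries (fun _ => 0) x).
    - apply PSeries_le; [exact Hx| |now rewrite CV_radius_decr_1].
      intros n. split; [lra|apply Hu].
    - apply PSeries_const_0. }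
  nra.
Qed.

Lemma is_derive_0_const (f : R -> R) (x : R) :
  0 <= x -> (forall t, 0 <= t <= x -> is_derive f t 0) -> f x = f 0.
Proof.
  intros Hx Hf.
  destruct (MVT_gen f 0 x (fun _ => 0)) as [c [_ Hc]].
  - rewrite Rmin_left, Rmax_right by lra. intros t Ht. apply Hf. lra.
  - rewrite Rmin_left, Rmax_right by lra. intros t Ht.
    apply derivable_continuous_pt. exists 0. apply is_derive_Reals, Hf. lra.
  - lra.
Qed.

(** * The equation satisfied by the moment generating function *)

(** The generating function [F] of the moments. *)
Definition moment_gf (x : R) : R := PSeries moment3 x.

Lemma moment3_radius (x : R) : Rabs x < 1 / 9 -> Rbar_lt (Rabs x) (CV_radius moment3).
Proof. intros H. eapply Rbar_lt_le_trans; [|apply CV_radius_moment3]. exact H. Qed.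

Lemma moment_gf_ode_series (x : R) :
  Rabs x < 1 / 9 ->
  (1 - x) * (1 - 9 * x) * PSeries (theta_derive_coef moment3) x
  = (10 - 18 * x) * PSeries (theta_coef moment3) x + (3 - 9 * x) * moment_gf x.
Proof.
  intros Hx. apply moment3_radius in Hx. unfold moment_gf.
  set (f0 := PSeries moment3 x). set (f1 := PSeries (theta_coef moment3) x).
  set (g := PSeries (theta_derive_coef moment3) x).
  pose proof (is_pseries_PSeries _ _ Hx) as P0. fold f0 in P0.
  pose proof (is_pseries_theta _ _ Hx) as P1. fold f1 in P1.
  pose proof (is_pseries_theta_derive _ _ Hx) as Pg. fold g in Pg.
  (* the series of [(n + 1)^2 A_n], which shifted by one is that of [n^2 A_(n-1)] *)
  pose proof (is_pseries_plus_R _ _ _ _ _ (is_pseries_incr_R _ _ _ Pg)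
    (is_pseries_plus_R _ _ _ _ _ (is_pseries_scal_R 2 _ _ _ P1) P0)) as Q.
  pose proof (is_pseries_plus_R _ _ _ _ _
    (is_pseries_plus_R _ _ _ _ _ (is_pseries_scal_R 10 _ _ _ (is_pseries_incr_R _ _ _ Pg))
       (is_pseries_plus_R _ _ _ _ _ (is_pseries_scal_R 10 _ _ _ P1)
          (is_pseries_scal_R 3 _ _ _ P0)))
    (is_pseries_scal_R (-9) _ _ _ (is_pseries_incr_R _ _ _ Q))) as T.
  assert (E : g = 10 * (x * g) + (10 * f1 + 3 * f0) + -9 * (x * (x * g + (2 * f1 + f0)))).
  { apply is_pseries_unique in T. rewrite <- T. unfold g. apply PSeries_ext.
    intros [|[|n]]; unfold theta_derive_coef, theta_coef, PS_incr_1; change zero with 0.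
    - rewrite moment3_0, moment3_1. simpl. ring.
    - pose proof (moment3_rec 0) as H. rewrite moment3_0, moment3_1 in *. simpl in *. lra.
    - pose proof (moment3_rec (S n)) as H. rewrite !S_INR in *. lra. }
  lra.
Qed.

(** The flux [P F'], with [P = x (1 - x) (1 - 9 x)], written without division. *)
Definition gf_flux (x : R) : R := (1 - x) * (1 - 9 * x) * PSeries (theta_coef moment3) x.

Lemma is_derive_gf_flux (x : R) : Rabs x < 1 / 9 -> is_derive gf_flux x ((3 - 9 * x) * moment_gf x).
Proof.
  intros Hx. pose proof (moment_gf_ode_series x Hx) as E.
  pose proof (is_derive_PSeries_theta _ _ (moment3_radius x Hx)) as D.
  replace ((3 - 9 * x) * moment_gf x) with
    ((-10 + 18 * x) * PSeries (theta_coef moment3) x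
     + (1 - x) * (1 - 9 * x) * PSeries (theta_derive_coef moment3) x) by lra.
  apply (is_derive_mult (fun t => (1 - t) * (1 - 9 * t)) (PSeries (theta_coef moment3)) x);
    [|exact D|intros; apply Rmult_comm].
  auto_derive; [trivial|ring].
Qed.

(** * The hypergeometric function *)

(** The coefficients of [2F1(1/3, 2/3; 1; z)]. *)
Definition hyp_coef (n : nat) : R :=
  pochhammer (1 / 3) n * pochhammer (2 / 3) n / pochhammer 1 n / INR (fact n).

(** The hypergeometric function of the cubic transformation. *)
Definition cubic_hyp (z : R) : R := hyp2F1 (1 / 3) (2 / 3) 1 z.

Lemma cubic_hyp_PSeries (z : R) : cubic_hyp z = PSeries hyp_coef z.
Proof.
  apply Series_ext. intros n. unfold hyp_coef, Rdiv. ring.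
Qed.

Lemma pochhammer_1 (n : nat) : pochhammer 1 n = INR (fact n).
Proof.
  induction n as [|n IH]; [reflexivity|].
  change (fact (S n)) with ((S n) * fact n)%nat.
  rewrite mult_INR, S_INR, <- IH. simpl. ring.
Qed.

Lemma hyp_coef_0 : hyp_coef 0 = 1.
Proof. unfold hyp_coef. simpl. field. Qed.

Lemma hyp_coef_rec (n : nat) :
  INR (S n) ^ 2 * hyp_coef (S n) = (INR n ^ 2 + INR n + 2 / 9) * hyp_coef n.
Proof.
  unfold hyp_coef. rewrite !pochhammer_1.
  change (fact (S n)) with ((S n) * fact n)%nat.
  rewrite mult_INR, S_INR. simpl pochhammer.
  pose proof (INR_fact_neq_0 n). pose proof (pos_INR n). field. split; [assumption|lra].
Qed.

Lemma hyp_coef_bounds (n : nat) : 0 < hyp_coef n <= 1.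
Proof.
  induction n as [|n IH].
  - rewrite hyp_coef_0. lra.
  - pose proof (hyp_coef_rec n) as E. rewrite S_INR in E. pose proof (pos_INR n) as Hn.
    split.
    + apply Rmult_lt_reg_l with ((INR n + 1) ^ 2); [nra|]. rewrite E. nra.
    + apply Rmult_le_reg_l with ((INR n + 1) ^ 2); [nra|]. rewrite E. nra.
Qed.

(** The coefficients decay no faster than those of the harmonic series. *)
Lemma hyp_coef_harmonic (n : nat) : 2 / 9 <= INR (S n) * hyp_coef (S n).
Proof.
  induction n as [|n IH].
  - pose proof (hyp_coef_rec 0) as E. rewrite hyp_coef_0 in E. simpl in *. lra.
  - pose proof (hyp_coef_rec (S n)) as E. pose proof (hyp_coef_bounds (S n)) as B.
    rewrite (S_INR (S n)) in *.
    assert (Hn : 0 < INR (S n)) by (apply lt_0_INR; lia).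
    set (m := INR (S n)) in *. set (h1 := hyp_coef (S n)) in *.
    set (h2 := hyp_coef (S (S n))) in *.
    apply Rle_trans with (m * h1); [exact IH|].
    apply Rmult_le_reg_l with (m + 1); [lra|]. nra.
Qed.

Lemma hyp_radius (z : R) : Rabs z < 1 -> Rbar_lt (Rabs z) (CV_radius hyp_coef).
Proof.
  intros Hz. apply Rbar_lt_le_trans with 1; [exact Hz|].
  apply (CV_radius_ge _ 1). intros n. rewrite pow1, Rmult_1_r.
  pose proof (hyp_coef_bounds n). rewrite Rabs_pos_eq; lra.
Qed.

(** The flux [z (1 - z) H'(z)] of [H = cubic_hyp], see [hyp_flux_eq]. *)
Definition hyp_flux (z : R) : R := (1 - z) * PSeries (theta_coef hyp_coef) z.

Definition cubic_hyp_deriv (z : R) : R := PSeries (PS_derive hyp_coef) z.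

Lemma is_derive_cubic_hyp (z : R) : Rabs z < 1 -> is_derive cubic_hyp z (cubic_hyp_deriv z).
Proof.
  intros Hz. apply (is_derive_ext (PSeries hyp_coef)).
  - intros t. symmetry. apply cubic_hyp_PSeries.
  - apply is_derive_PSeries, hyp_radius, Hz.
Qed.

Lemma hyp_flux_eq (z : R) : hyp_flux z = z * (1 - z) * cubic_hyp_deriv z.
Proof. unfold hyp_flux. rewrite PSeries_theta. unfold cubic_hyp_deriv. ring. Qed.

(** Euler's differential equation, in self-adjoint form. *)
Lemma is_derive_hyp_flux (z : R) : Rabs z < 1 -> is_derive hyp_flux z (2 / 9 * cubic_hyp z).
Proof.
  intros Hz. apply hyp_radius in Hz.
  set (h0 := PSeries hyp_coef z). set (h1 := PSeries (theta_coef hyp_coef) z).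
  set (g := PSeries (theta_derive_coef hyp_coef) z).
  pose proof (is_pseries_PSeries _ _ Hz) as P0. fold h0 in P0.
  pose proof (is_pseries_theta _ _ Hz) as P1. fold h1 in P1.
  pose proof (is_pseries_theta_derive _ _ Hz) as Pg. fold g in Pg.
  pose proof (is_pseries_plus_R _ _ _ _ _ (is_pseries_incr_R _ _ _ Pg)
    (is_pseries_plus_R _ _ _ _ _ P1 (is_pseries_scal_R (2 / 9) _ _ _ P0))) as T.
  assert (E : g = z * g + (h1 + 2 / 9 * h0)).
  { apply is_pseries_unique in T. rewrite <- T. unfold g. apply PSeries_ext.
    intros n. unfold theta_derive_coef at 1. rewrite hyp_coef_rec.
    destruct n as [|n]; unfold theta_derive_coef, theta_coef, PS_incr_1.
    - change zero with 0. simpl. ring.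
    - ring. }
  rewrite cubic_hyp_PSeries. fold h0.
  replace (2 / 9 * h0) with (-1 * h1 + (1 - z) * g) by lra.
  apply (is_derive_mult (fun t => 1 - t) (PSeries (theta_coef hyp_coef)) z);
    [|apply is_derive_PSeries_theta, Hz|intros; apply Rmult_comm].
  auto_derive; [trivial|ring].
Qed.

Lemma cubic_hyp_ge_1 (z : R) : 0 <= z < 1 -> 1 <= cubic_hyp z.
Proof.
  intros Hz. rewrite cubic_hyp_PSeries, <- hyp_coef_0. apply PSeries_ge_head.
  - lra.
  - intros n. apply Rlt_le, hyp_coef_bounds.
  - apply hyp_radius. rewrite Rabs_pos_eq; lra.
Qed.

(** The hypergeometric function has a logarithmic singularity at [1]. *)
Lemma cubic_hyp_log (z : R) : 0 <= z < 1 -> 1 - 2 / 9 * ln (1 - z) <= cubic_hyp z.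
Proof.
  intros Hz.
  assert (HdH : forall t, 0 <= t < 1 -> 2 / 9 / (1 - t) <= cubic_hyp_deriv t).
  { intros t Ht.
    replace (2 / 9 / (1 - t)) with (PSeries (fun _ => 2 / 9) t).
    - apply PSeries_le; [lra| |].
      + intros n. split; [lra|]. apply hyp_coef_harmonic.
      + rewrite CV_radius_derive. apply hyp_radius. rewrite Rabs_pos_eq; lra.
    - unfold PSeries. rewrite Series_scal_l, Series_geom; [reflexivity|].
      rewrite Rabs_pos_eq; lra. }
  set (f := fun t => cubic_hyp t + 2 / 9 * ln (1 - t)).
  set (df := fun t => cubic_hyp_deriv t - 2 / 9 / (1 - t)).
  assert (Hf : forall t, 0 <= t <= z -> is_derive f t (df t)).
  { intros t Ht. unfold f, df.
    apply (is_derive_plus cubic_hyp (fun t => 2 / 9 * ln (1 - t)) t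
      (cubic_hyp_deriv t) (- (2 / 9 / (1 - t)))).
    - apply is_derive_cubic_hyp. rewrite Rabs_pos_eq; lra.
    - auto_derive; [lra|]. field. lra. }
  destruct (MVT_gen f 0 z df) as [c [Hc E]].
  - rewrite Rmin_left, Rmax_right by lra. intros t Ht. apply Hf. lra.
  - rewrite Rmin_left, Rmax_right by lra. intros t Ht.
    apply derivable_continuous_pt. exists (df t). apply is_derive_Reals, Hf. lra.
  - rewrite Rmin_left, Rmax_right in Hc by lra.
    assert (Hdf : 0 <= df c) by (unfold df; pose proof (HdH c ltac:(lra)); lra).
    assert (H0 : f 0 = 1).
    { unfold f. rewrite cubic_hyp_PSeries, PSeries_0, hyp_coef_0, Rminus_0_r, ln_1. ring. }
    rewrite H0 in E. unfold f in E. nra.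
Qed.

(** * The cubic change of variable *)

(** The argument [z] of the cubic transformation. *)
Definition cubic_arg (x : R) : R := 27 * x ^ 2 * (1 - x) / (1 - 3 * x) ^ 3.

Lemma cubic_arg_compl (x : R) : x < 1 / 3 -> 1 - cubic_arg x = (1 - 9 * x) / (1 - 3 * x) ^ 3.
Proof. intros Hx. unfold cubic_arg. field. lra. Qed.

Lemma cubic_arg_bounds (x : R) : 0 <= x < 1 / 9 -> 0 <= cubic_arg x < 1.
Proof.
  intros Hx.
  assert (Hp : 0 < (1 - 3 * x) ^ 3) by (apply pow_lt; lra).
  split.
  - unfold cubic_arg. apply Rmult_le_pos; [nra|]. left. now apply Rinv_0_lt_compat.
  - pose proof (cubic_arg_compl x ltac:(lra)) as E.
    assert (0 < (1 - 9 * x) / (1 - 3 * x) ^ 3) by (apply Rdiv_lt_0_compat; lra). lra.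
Qed.

Lemma is_derive_cubic_arg (x : R) : x < 1 / 3 -> is_derive cubic_arg x (54 * x / (1 - 3 * x) ^ 4).
Proof.
  intros Hx. unfold cubic_arg. auto_derive.
  - repeat apply Rmult_integral_contrapositive_currified; lra.
  - field. lra.
Qed.

(** The leading coefficient [P] of the equation of [F]; it vanishes at [0]. *)
Definition ode_weight (x : R) : R := x * (1 - x) * (1 - 9 * x).

(** The right-hand side [Y] of the cubic transformation. *)
Definition pullback (x : R) : R := cubic_hyp (cubic_arg x) / (1 - 3 * x).

(** The flux [P Y'], see [pullback_flux_eq], in a form whose derivative needs only the
    first-order relation [is_derive_hyp_flux] and no second derivative. *)
Definition pullback_flux (x : R) : R :=
  2 * hyp_flux (cubic_arg x) * (1 - 3 * x)
  + 3 * ode_weight x * cubic_hyp (cubic_arg x) / (1 - 3 * x) ^ 2.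

Definition pullback_deriv (x : R) : R :=
  54 * x / (1 - 3 * x) ^ 4 * cubic_hyp_deriv (cubic_arg x) / (1 - 3 * x)
  + 3 * cubic_hyp (cubic_arg x) / (1 - 3 * x) ^ 2.

Lemma is_derive_cubic_hyp_arg (x : R) :
  0 <= x < 1 / 9 ->
  is_derive (fun t => cubic_hyp (cubic_arg t)) x
    (54 * x / (1 - 3 * x) ^ 4 * cubic_hyp_deriv (cubic_arg x)).
Proof.
  intros Hx. pose proof (cubic_arg_bounds x Hx).
  apply (is_derive_comp cubic_hyp cubic_arg).
  - apply is_derive_cubic_hyp. rewrite Rabs_pos_eq; lra.
  - apply is_derive_cubic_arg. lra.
Qed.

Lemma is_derive_hyp_flux_arg (x : R) :
  0 <= x < 1 / 9 ->
  is_derive (fun t => hyp_flux (cubic_arg t)) x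
    (54 * x / (1 - 3 * x) ^ 4 * (2 / 9 * cubic_hyp (cubic_arg x))).
Proof.
  intros Hx. pose proof (cubic_arg_bounds x Hx).
  apply (is_derive_comp hyp_flux cubic_arg).
  - apply is_derive_hyp_flux. rewrite Rabs_pos_eq; lra.
  - apply is_derive_cubic_arg. lra.
Qed.

Lemma is_derive_pullback (x : R) : 0 <= x < 1 / 9 -> is_derive pullback x (pullback_deriv x).
Proof.
  intros Hx. unfold pullback, pullback_deriv.
  pose proof (is_derive_cubic_hyp_arg x Hx) as D.
  evar_last.
  - apply (is_derive_mult (fun t => cubic_hyp (cubic_arg t)) (fun t => / (1 - 3 * t)));
      [exact D| |intros; apply Rmult_comm].
    auto_derive; [lra|reflexivity].
  - change plus with Rplus. change mult with Rmult. field. lra.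
Qed.

Lemma pullback_flux_eq (x : R) : x < 1 / 9 -> pullback_flux x = ode_weight x * pullback_deriv x.
Proof.
  intros Hx. unfold pullback_flux, pullback_deriv. rewrite hyp_flux_eq, cubic_arg_compl by lra.
  generalize (cubic_hyp (cubic_arg x)) (cubic_hyp_deriv (cubic_arg x)). intros h d.
  unfold cubic_arg, ode_weight. field. lra.
Qed.

Lemma is_derive_pullback_flux (x : R) :
  0 <= x < 1 / 9 -> is_derive pullback_flux x ((3 - 9 * x) * pullback x).
Proof.
  intros Hx. unfold pullback_flux, pullback.
  pose proof (is_derive_cubic_hyp_arg x Hx) as D1.
  pose proof (is_derive_hyp_flux_arg x Hx) as D2.
  evar_last.
  - apply (is_derive_plus (fun t => 2 * hyp_flux (cubic_arg t) * (1 - 3 * t))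
      (fun t => 3 * ode_weight t * cubic_hyp (cubic_arg t) / (1 - 3 * t) ^ 2)).
    + apply (is_derive_ext (fun t => hyp_flux (cubic_arg t) * (2 * (1 - 3 * t)))).
      { intros t. simpl. ring. }
      apply (is_derive_mult (fun t => hyp_flux (cubic_arg t)) (fun t => 2 * (1 - 3 * t)));
        [exact D2| |intros; apply Rmult_comm].
      auto_derive; [trivial|reflexivity].
    + apply (is_derive_ext (fun t => cubic_hyp (cubic_arg t)
        * (3 * ode_weight t / (1 - 3 * t) ^ 2))).
      { intros t. unfold Rdiv. simpl. ring. }
      apply (is_derive_mult (fun t => cubic_hyp (cubic_arg t))
        (fun t => 3 * ode_weight t / (1 - 3 * t) ^ 2));
        [exact D1| |intros; apply Rmult_comm].
      unfold ode_weight. auto_derive; [|reflexivity].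
      repeat apply Rmult_integral_contrapositive_currified; lra.
  - change plus with Rplus. change mult with Rmult.
    rewrite hyp_flux_eq, cubic_arg_compl by lra.
    generalize (cubic_hyp (cubic_arg x)) (cubic_hyp_deriv (cubic_arg x)). intros h d.
  unfold cubic_arg, ode_weight. field. lra.
Qed.

Lemma moment_gf_ge_1 (x : R) : 0 <= x < 1 / 9 -> 1 <= moment_gf x.
Proof.
  intros Hx. unfold moment_gf. rewrite <- moment3_0 at 1. apply PSeries_ge_head.
  - lra.
  - intros n. pose proof (moment3_ge_1 n). lra.
  - apply moment3_radius. rewrite Rabs_pos_eq; lra.
Qed.

Lemma moment_gf_0 : moment_gf 0 = 1.
Proof. unfold moment_gf. rewrite PSeries_0. apply moment3_0. Qed.

Lemma pullback_0 : pullback 0 = 1.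
Proof.
  unfold pullback. replace (cubic_arg 0) with 0 by (unfold cubic_arg; field).
  rewrite cubic_hyp_PSeries, PSeries_0, hyp_coef_0. field.
Qed.

Definition moment_gf_deriv (x : R) : R := PSeries (PS_derive moment3) x.

Lemma is_derive_moment_gf (x : R) : Rabs x < 1 / 9 -> is_derive moment_gf x (moment_gf_deriv x).
Proof. intros Hx. apply is_derive_PSeries, moment3_radius, Hx. Qed.

Lemma gf_flux_eq (x : R) : gf_flux x = ode_weight x * moment_gf_deriv x.
Proof. unfold gf_flux, ode_weight. rewrite PSeries_theta. unfold moment_gf_deriv. ring. Qed.

(** [P] times the Wronskian of [F] and [Y]. *)
Lemma wronskian (x : R) :
  0 <= x < 1 / 9 -> moment_gf x * pullback_flux x - pullback x * gf_flux x = 0.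
Proof.
  intros Hx.
  assert (E : moment_gf 0 * pullback_flux 0 - pullback 0 * gf_flux 0 = 0).
  { rewrite gf_flux_eq, pullback_flux_eq by lra. unfold ode_weight. ring. }
  rewrite <- E.
  apply (is_derive_0_const
    (fun t => moment_gf t * pullback_flux t - pullback t * gf_flux t)); [lra|].
  intros t Ht.
  assert (Hat : Rabs t < 1 / 9) by (rewrite Rabs_pos_eq; lra).
  pose proof (is_derive_moment_gf t Hat) as DF. pose proof (is_derive_gf_flux t Hat) as DU.
  pose proof (is_derive_pullback t ltac:(lra)) as DY.
  pose proof (is_derive_pullback_flux t ltac:(lra)) as DW.
  evar_last.
  - apply (is_derive_minus (fun s => moment_gf s * pullback_flux s)
      (fun s => pullback s * gf_flux s)).
    + apply (is_derive_mult moment_gf pullback_flux); [exact DF|exact DW|intros; apply Rmult_comm].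
    + apply (is_derive_mult pullback gf_flux); [exact DY|exact DU|intros; apply Rmult_comm].
  - unfold minus. change plus with Rplus. change mult with Rmult. change opp with Ropp.
    rewrite gf_flux_eq, pullback_flux_eq by lra. ring.
Qed.

(** The cubic transformation.  The quotient of the two sides has derivative zero: away
    from [0] because the Wronskian vanishes, and at [0] by inspection. *)
Lemma moment_gf_hypergeometric (x : R) :
  0 <= x < 1 / 9 -> moment_gf x = / (1 - 3 * x) * hyp2F1 (1 / 3) (2 / 3) 1 (cubic_arg x).
Proof.
  intros Hx. fold (cubic_hyp (cubic_arg x)).
  assert (E : pullback x / moment_gf x = 1).
  { replace 1 with (pullback 0 / moment_gf 0) by (rewrite pullback_0, moment_gf_0; field).
    apply (is_derive_0_const (fun t => pullback t / moment_gf t)); [lra|].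
    intros t Ht.
    assert (Hat : Rabs t < 1 / 9) by (rewrite Rabs_pos_eq; lra).
    pose proof (moment_gf_ge_1 t ltac:(lra)) as HF.
    pose proof (is_derive_moment_gf t Hat) as DF.
    pose proof (is_derive_pullback t ltac:(lra)) as DY.
    evar_last; [apply (is_derive_div pullback moment_gf); [exact DY|exact DF|lra]|].
    pose proof (wronskian t ltac:(lra)) as V.
    rewrite gf_flux_eq, pullback_flux_eq in V by lra.
    destruct (Req_dec t 0) as [->|Ht0].
    - (* [Y'(0) = F'(0) = 3] *)
      replace (pullback_deriv 0) with 3.
      2:{ unfold pullback_deriv. replace (cubic_arg 0) with 0 by (unfold cubic_arg; field).
          rewrite cubic_hyp_PSeries, PSeries_0, hyp_coef_0. field. }
      replace (moment_gf_deriv 0) with 3.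
      2:{ unfold moment_gf_deriv. rewrite PSeries_0. unfold PS_derive.
          rewrite moment3_1. simpl. ring. }
      rewrite moment_gf_0, pullback_0. unfold Rdiv. ring.
    - assert (HP : 0 < ode_weight t) by (unfold ode_weight; repeat apply Rmult_lt_0_compat; lra).
      assert (E : pullback_deriv t * moment_gf t - pullback t * moment_gf_deriv t = 0).
      { apply Rmult_eq_reg_l with (ode_weight t); [|lra]. lra. }
      rewrite E. unfold Rdiv. ring. }
  assert (HF := moment_gf_ge_1 x Hx).
  replace (moment_gf x) with (pullback x).
  - unfold pullback. field. lra.
  - apply Rmult_eq_reg_r with (/ moment_gf x); [|apply Rinv_neq_0_compat; lra].
    unfold Rdiv in E. rewrite E. symmetry. apply Rinv_r. lra.
Qed.

(** * The matrix of Fourier coefficients *)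
Lemma quad_form_eq (a : R) (b : C) (c : R) (x0 x1 x2 x3 : C) :
  quad_form (coeff_matrix a b c) ((x0, tt), ((x1, tt), ((x2, tt), ((x3, tt), tt))))
  = (Cconj x0 * (RtoC a * x0 + Cconj b * x1 + Cconj b * x2 + Cconj b * x3) +
     Cconj x1 * (b * x0 + RtoC a * x1 + RtoC c * x2 + RtoC c * x3) +
     Cconj x2 * (b * x0 + RtoC c * x1 + RtoC a * x2 + RtoC c * x3) +
     Cconj x3 * (b * x0 + RtoC c * x1 + RtoC c * x2 + RtoC a * x3))%C.
Proof.
  cbn -[sum_n RtoC Cconj]. rewrite !sum_Sn, !sum_O.
  cbn -[sum_n RtoC Cconj Cplus Cmult]. reflexivity.
Qed.

Lemma Cmod_sq (z : C) : Cmod z ^ 2 = fst z ^ 2 + snd z ^ 2.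
Proof. unfold Cmod. apply pow2_sqrt. nra. Qed.

(** Completion of the squares in the Hermitian form of the matrix. *)
Lemma quad_form_squares (a : R) (b : C) (c : R) (x0 x1 x2 x3 : C) :
  let Q := quad_form (coeff_matrix a b c)
             ((x0, tt), ((x1, tt), ((x2, tt), ((x3, tt), tt)))) in
  let s := (x1 + x2 + x3)%C in
  Im Q = 0 /\
  a * Re Q = Cmod (RtoC a * x0 + Cconj b * s) ^ 2
             + (a * (a + 2 * c) / 3 - Cmod b ^ 2) * Cmod s ^ 2
             + a * (a - c) / 3
               * (Cmod (x1 - x2) ^ 2 + Cmod (x2 - x3) ^ 2 + Cmod (x1 - x3) ^ 2).
Proof.
  intros Q s. unfold Q, s. rewrite quad_form_eq, !Cmod_sq.
  destruct b, x0, x1, x2, x3. unfold Im, Re. simpl. split; field.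
Qed.

Lemma pos_def_suff (a : R) (b : C) (c : R) :
  0 < a -> c < a -> 3 * Cmod b ^ 2 < a * (a + 2 * c) ->
  pos_def (coeff_matrix a b c).
Proof.
  intros Ha Hc Hb [[x0 []] [[x1 []] [[x2 []] [[x3 []] []]]]] Hx.
  destruct (quad_form_squares a b c x0 x1 x2 x3) as [HI HR].
  split; [exact HI|].
  set (Q := Re _) in *. clearbody Q.
  destruct (Rlt_le_dec 0 Q) as [|HQ]; [assumption|exfalso; apply Hx].
  assert (Hk2 : 0 < a * (a + 2 * c) / 3 - Cmod b ^ 2) by lra.
  assert (Hk3 : 0 < a * (a - c) / 3) by nra.
  assert (HaQ : a * Q <= 0) by nra.
  set (k2 := a * (a + 2 * c) / 3 - Cmod b ^ 2) in *.
  set (k3 := a * (a - c) / 3) in *.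
  pose proof (pow2_ge_0 (Cmod (RtoC a * x0 + Cconj b * (x1 + x2 + x3)))) as T1.
  pose proof (pow2_ge_0 (Cmod (x1 + x2 + x3))) as T2.
  pose proof (pow2_ge_0 (Cmod (x1 - x2))) as T3.
  pose proof (pow2_ge_0 (Cmod (x2 - x3))) as T4.
  pose proof (pow2_ge_0 (Cmod (x1 - x3))) as T5.
  assert (Hz : forall z : C, Cmod z ^ 2 <= 0 -> z = RtoC 0).
  { intros z Hz'. apply Cmod_eq_0. pose proof (Cmod_ge_0 z). nra. }
  pose proof (Rmult_le_pos _ _ (Rlt_le _ _ Hk2) T2) as M2.
  pose proof (Rmult_le_pos _ _ (Rlt_le _ _ Hk3) T3) as M3.
  pose proof (Rmult_le_pos _ _ (Rlt_le _ _ Hk3) T4) as M4.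
  pose proof (Rmult_le_pos _ _ (Rlt_le _ _ Hk3) T5) as M5.
  assert (E1 := Hz (RtoC a * x0 + Cconj b * (x1 + x2 + x3))%C ltac:(lra)).
  assert (E2 := Hz (x1 + x2 + x3)%C ltac:(apply Rmult_le_reg_l with k2; lra)).
  assert (E3 := Hz (x1 - x2)%C ltac:(apply Rmult_le_reg_l with k3; lra)).
  assert (E4 := Hz (x2 - x3)%C ltac:(apply Rmult_le_reg_l with k3; lra)).
  rewrite E2 in E1.
  destruct x0, x1, x2, x3. unfold Cmult, Cplus, Cminus, Copp, RtoC, Cconj in *. simpl in *.
  injection E1 as E1 E1'. injection E2 as E2 E2'.
  injection E3 as E3 E3'. injection E4 as E4 E4'.
  assert (r = 0) by (apply Rmult_eq_reg_l with a; lra).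
  assert (r0 = 0) by (apply Rmult_eq_reg_l with a; lra).
  replace r with 0 by lra. replace r0 with 0 by lra. replace r1 with 0 by lra.
  replace r2 with 0 by lra. replace r3 with 0 by lra. replace r4 with 0 by lra.
  replace r5 with 0 by lra. replace r6 with 0 by lra. reflexivity.
Qed.

(** Positivity at the first basis vector gives [0 < a]. *)
Lemma pos_def_nec (a : R) (b : C) (c : R) :
  pos_def (coeff_matrix a b c) -> 0 < a /\ 3 * Cmod b ^ 2 < a * (a + 2 * c).
Proof.
  intros H.
  assert (Ha : 0 < a).
  { destruct (H ((RtoC 1, tt), ((RtoC 0, tt), ((RtoC 0, tt), ((RtoC 0, tt), tt))))) as [_ HR].
    - intros E. unfold mk_matrix, mk_Tn in E. simpl in E. injection E as E. lra.
    - rewrite quad_form_eq in HR. destruct b. simpl in HR. lra. }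
  split; [exact Ha|].
  (* the vector at which the first square vanishes *)
  set (x0 := (- (RtoC 3 * Cconj b))%C).
  destruct (H ((x0, tt), ((RtoC a, tt), ((RtoC a, tt), ((RtoC a, tt), tt))))) as [_ HR].
  - intros E. unfold mk_matrix, mk_Tn in E. simpl in E. injection E as E. lra.
  - destruct (quad_form_squares a b c x0 (RtoC a) (RtoC a) (RtoC a)) as [_ E].
    pose proof (Rmult_lt_0_compat _ _ Ha HR) as HaR. rewrite E in HaR. clear E HR.
    replace (RtoC a * x0 + Cconj b * (RtoC a + RtoC a + RtoC a))%C with (RtoC 0) in HaR.
    2:{ unfold x0. apply injective_projections; simpl; ring. }
    replace (RtoC a - RtoC a)%C with (RtoC 0) in HaR by ring.
    rewrite Cmod_0, <- !RtoC_plus, Cmod_R in HaR.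
    rewrite Rabs_pos_eq in HaR by lra.
    assert (0 < (a * (a + 2 * c) / 3 - Cmod b ^ 2) * (9 * a ^ 2)) by lra.
    assert (0 < 9 * a ^ 2) by nra.
    assert (0 < a * (a + 2 * c) / 3 - Cmod b ^ 2) by nra. lra.
Qed.

Lemma solves_matrix_equation_iff (a : R) (b : C) (c : R) (p0 p1 : C) :
  solves_matrix_equation a b c p0 p1 <->
  (RtoC a * RtoC (Cmod p0 ^ 2) + RtoC 3 * Cconj b * (p1 * Cconj p0))%C = RtoC 1 /\
  (b * RtoC (Cmod p0 ^ 2) + RtoC (a + 2 * c) * (p1 * Cconj p0))%C = RtoC 0.
Proof.
  set (u := RtoC (Cmod p0 ^ 2)). set (v := (p1 * Cconj p0)%C).
  assert (E1 : (RtoC a * u + Cconj b * v + Cconj b * v + Cconj b * v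
    = RtoC a * u + RtoC 3 * Cconj b * v)%C).
  { apply injective_projections; simpl; ring. }
  assert (E2 : (b * u + RtoC a * v + RtoC c * v + RtoC c * v
    = b * u + RtoC (a + 2 * c) * v)%C).
  { apply injective_projections; simpl; ring. }
  assert (E : solves_matrix_equation a b c p0 p1 <->
    (((RtoC a * u + Cconj b * v + Cconj b * v + Cconj b * v)%C, tt),
     (((b * u + RtoC a * v + RtoC c * v + RtoC c * v)%C, tt),
     (((b * u + RtoC c * v + RtoC a * v + RtoC c * v)%C, tt),
     (((b * u + RtoC c * v + RtoC c * v + RtoC a * v)%C, tt), tt))))
    = ((RtoC 1, tt), ((RtoC 0, tt), ((RtoC 0, tt), ((RtoC 0, tt), tt))))).
  { unfold solves_matrix_equation. fold u v. clearbody u v.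
    cbn -[sum_n RtoC Cconj]. rewrite !sum_Sn, !sum_O.
    cbn -[sum_n RtoC Cconj Cplus Cmult]. reflexivity. }
  rewrite E, <- E1, <- E2. split.
  - intros T. split.
    + exact (f_equal (fun m => fst (fst m)) T).
    + exact (f_equal (fun m => fst (fst (snd m))) T).
  - intros [T1 T2]. rewrite T1, T2.
    replace (b * u + RtoC c * v + RtoC a * v + RtoC c * v)%C with (RtoC 0)
      by (rewrite <- T2; ring).
    replace (b * u + RtoC c * v + RtoC c * v + RtoC a * v)%C with (RtoC 0)
      by (rewrite <- T2; ring).
    reflexivity.
Qed.

(** * Range of the ratio of the two coefficients *)
(** The series [F1 = (F - 1) / x]. *)
Definition moment_gf_tail (x : R) : R := PSeries (fun n => moment3 (S n)) x.

Lemma moment_gf_tail_eq (x : R) : Rabs x < 1 / 9 -> moment_gf x = 1 + x * moment_gf_tail x.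
Proof.
  intros Hx. unfold moment_gf, moment_gf_tail.
  rewrite PSeries_decr_1 by (apply CV_radius_inside, moment3_radius, Hx).
  rewrite moment3_0. reflexivity.
Qed.

Lemma moment_gf_tail_lt (x : R) : 0 <= x < 1 / 9 -> 0 <= moment_gf_tail x < 9 * moment_gf x.
Proof.
  intros Hx.
  assert (Hr : Rabs x < 1 / 9) by (rewrite Rabs_pos_eq; lra).
  assert (Hr1 : Rbar_lt (Rabs x) (CV_radius (fun n => moment3 (S n)))).
  { eapply Rbar_lt_le_trans; [|apply CV_radius_moment3_succ]. exact Hr. }
  split.
  - apply Rle_trans with (moment3 1); [pose proof (moment3_ge_1 1); lra|].
    apply (PSeries_ge_head (fun n => moment3 (S n))); [lra| |exact Hr1].
    intros n. pose proof (moment3_ge_1 (S n)). lra.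
  - set (d := fun n => 9 * moment3 n + -1 * moment3 (S n)).
    assert (Hd : is_pseries d x (9 * moment_gf x + -1 * moment_gf_tail x)).
    { apply is_pseries_plus_R; apply is_pseries_scal_R; apply is_pseries_PSeries.
      - apply moment3_radius, Hr.
      - exact Hr1. }
    assert (H6 : 6 <= 9 * moment_gf x + -1 * moment_gf_tail x).
    { rewrite <- (is_pseries_unique _ _ _ Hd).
      replace 6 with (d 0%nat) by (unfold d; rewrite moment3_0, moment3_1; ring).
      apply PSeries_ge_head; [lra| |].
      - intros n. unfold d. pose proof (moment3_growth n). lra.
      - apply Rbar_lt_le_trans with (1 / 9); [exact Hr|].
        apply (CV_radius_ge _ 9). intros n. unfold d.
        pose proof (moment3_growth n). pose proof (moment3_ge_1 n).
        pose proof (moment3_ge_1 (S n)). pose proof (moment3_le n).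
        assert (0 < 9 ^ n) by (apply pow_lt; lra).
        replace (1 / 9) with (/ 9) by field. rewrite pow_inv.
        rewrite Rabs_pos_eq.
        + apply Rmult_le_reg_r with (9 ^ n); [lra|]. rewrite Rmult_assoc, Rinv_l; lra.
        + apply Rmult_le_pos; [lra|]. left. now apply Rinv_0_lt_compat. }
    lra.
Qed.

Lemma moment_gf_continuous (x : R) : Rabs x < 1 / 9 -> continuity_pt moment_gf x.
Proof. intros Hx. apply PSeries_continuity, moment3_radius, Hx. Qed.

Lemma moment_gf_tail_continuous (x : R) : Rabs x < 1 / 9 -> continuity_pt moment_gf_tail x.
Proof.
  intros Hx. apply PSeries_continuity.
  eapply Rbar_lt_le_trans; [|apply CV_radius_moment3_succ]. exact Hx.
Qed.

Lemma moment_gf_ge_hyp (x : R) :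
  0 <= x < 1 / 9 ->
  1 <= cubic_hyp (cubic_arg x) <= moment_gf x /\
  1 <= moment_gf x * (1 - 3 * x).
Proof.
  intros Hx. pose proof (cubic_hyp_ge_1 _ (cubic_arg_bounds x Hx)) as H1.
  pose proof (moment_gf_hypergeometric x Hx) as E. fold (cubic_hyp (cubic_arg x)) in E.
  assert (E' : moment_gf x * (1 - 3 * x) = cubic_hyp (cubic_arg x)) by (rewrite E; field; lra).
  pose proof (moment_gf_ge_1 x Hx). split; [split; [exact H1|nra]|lra].
Qed.

(** The witness satisfies [1 - 9 x = 8 d / 27] with [d = exp (- 9 |M| / 2)]: as
    [(1 - 3 x)^3 >= 8/27], this makes [1 - z <= d]. *)
Lemma moment_gf_unbounded (M : R) : exists x : R, 0 < x < 1 / 9 /\ M <= moment_gf x.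
Proof.
  set (d := exp (- (9 / 2 * Rabs M))).
  assert (Hd : 0 < d <= 1).
  { unfold d. split; [apply exp_pos|]. rewrite <- exp_0. pose proof (Rabs_pos M).
    destruct (Req_dec (Rabs M) 0) as [->|].
    - right. f_equal. ring.
    - left. apply exp_increasing. lra. }
  exists ((1 - 8 / 27 * d) / 9).
  set (x := (1 - 8 / 27 * d) / 9).
  assert (Hx : 0 < x < 1 / 9) by (unfold x; lra).
  split; [exact Hx|].
  pose proof (cubic_arg_bounds x ltac:(lra)) as Hz.
  pose proof (cubic_hyp_log _ Hz) as HL.
  destruct (moment_gf_ge_hyp x ltac:(lra)) as [[_ HF] _].
  assert (Hzd : 1 - cubic_arg x <= d).
  { rewrite cubic_arg_compl by lra.
    assert (8 / 27 <= (1 - 3 * x) ^ 3).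
    { replace (8 / 27) with ((2 / 3) ^ 3) by field. apply pow_incr. lra. }
    apply Rmult_le_reg_r with ((1 - 3 * x) ^ 3); [lra|].
    unfold Rdiv. rewrite Rmult_assoc, Rinv_l by lra.
    replace (1 - 9 * x) with (8 / 27 * d) by (unfold x; field). nra. }
  assert (Hln : ln (1 - cubic_arg x) <= - (9 / 2 * Rabs M)).
  { rewrite <- (ln_exp (- (9 / 2 * Rabs M))). fold d.
    destruct (Req_dec (1 - cubic_arg x) d) as [->|]; [lra|].
    left. apply ln_increasing; lra. }
  pose proof (Rle_abs M). lra.
Qed.

(** Intermediate values: [y F1(y^2) / (3 F(y^2))] vanishes at [0] and exceeds [rho]
    where [F >= 1 / (1 - rho)]. *)
Lemma ratio_surjective (rho : R) :
  0 < rho < 1 ->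
  exists y : R, 0 < y < 1 / 3 /\ y * moment_gf_tail (y ^ 2) = 3 * rho * moment_gf (y ^ 2).
Proof.
  intros Hr.
  destruct (moment_gf_unbounded (/ (1 - rho))) as [x [Hx HM]].
  set (y1 := sqrt x).
  assert (Hy1 : 0 < y1) by (apply sqrt_lt_R0; lra).
  assert (Ey1 : y1 ^ 2 = x) by (apply pow2_sqrt; lra).
  assert (Hy1' : y1 < 1 / 3) by nra.
  set (psi := fun y => y * moment_gf_tail (y ^ 2) - 3 * rho * moment_gf (y ^ 2)).
  destruct (IVT_interv psi 0 y1) as [y [Hy Ey]].
  - intros y Hy.
    assert (Hy2 : Rabs (y ^ 2) < 1 / 9) by (rewrite Rabs_pos_eq; nra).
    assert (Hsq : continuity_pt (fun t => t ^ 2) y).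
    { apply derivable_continuous_pt, derivable_pt_pow. }
    apply continuity_pt_minus.
    + apply continuity_pt_mult; [apply derivable_continuous_pt, derivable_pt_id|].
      apply (continuity_pt_comp (fun t => t ^ 2) moment_gf_tail); [exact Hsq|].
      now apply moment_gf_tail_continuous.
    + apply (continuity_pt_scal (fun t => moment_gf (t ^ 2)) (3 * rho)).
      apply (continuity_pt_comp (fun t => t ^ 2) moment_gf); [exact Hsq|].
      now apply moment_gf_continuous.
  - exact Hy1.
  - unfold psi. replace (0 ^ 2) with 0 by ring. rewrite moment_gf_0. lra.
  - unfold psi. rewrite Ey1. apply Rmult_lt_reg_l with y1; [exact Hy1|].
    pose proof (moment_gf_tail_eq x ltac:(rewrite Rabs_pos_eq; lra)) as E.
    assert (1 <= moment_gf x * (1 - rho)).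
    { apply Rmult_le_reg_r with (/ (1 - rho)); [apply Rinv_0_lt_compat; lra|].
      rewrite Rmult_assoc, Rinv_r; lra. }
    pose proof (moment_gf_ge_1 x ltac:(lra)).
    assert (E2 : y1 * (y1 * moment_gf_tail x - 3 * rho * moment_gf x)
      = x * moment_gf_tail x - 3 * rho * y1 * moment_gf x)
      by (rewrite <- Ey1; ring).
    rewrite E2. assert (0 < rho * (1 - 3 * y1) * moment_gf x).
    { repeat apply Rmult_lt_0_compat; lra. }
    lra.
  - exists y. unfold psi in Ey.
    destruct (Req_dec y 0) as [->|Hy0].
    + replace (0 ^ 2) with 0 in Ey by ring. rewrite moment_gf_0 in Ey. lra.
    + split; [lra|lra].
Qed.

(** * Solutions and admissible values of [c] *)
Lemma hyp_argument_cubic_arg (a : R) (b : C) (c : R) :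
  0 < a + 2 * c -> 3 * Cmod b ^ 2 < (a + 2 * c) ^ 2 ->
  hyp_argument a b c = cubic_arg (Cmod b ^ 2 / (a + 2 * c) ^ 2).
Proof.
  intros HA HB. unfold hyp_argument, cubic_arg. field. repeat split; try lra.
Qed.

Lemma admissible_exists (a : R) (b : C) :
  Cmod b < a -> exists c : R, admissible a b c.
Proof.
  intros Hba. pose proof (Cmod_ge_0 b) as Hb.
  destruct (Req_dec (Cmod b) 0) as [Hb0|Hb0].
  - exists 0.
    assert (E : hyp_argument a b 0 = 0).
    { unfold hyp_argument, Rdiv. rewrite Hb0. ring. }
    unfold admissible. rewrite E. split; [|split; [|split]].
    + lra.
    + rewrite Rabs_R0. lra.
    + fold (cubic_hyp 0). rewrite cubic_hyp_PSeries, PSeries_0, hyp_coef_0, Hb0. field. lra.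
    + apply pos_def_suff; [lra|lra|]. rewrite Hb0. nra.
  - set (rho := Cmod b / a).
    assert (Hrho : 0 < rho < 1).
    { unfold rho. split; [apply Rdiv_lt_0_compat; lra|].
      apply Rmult_lt_reg_r with a; [lra|]. unfold Rdiv. rewrite Rmult_assoc, Rinv_l; lra. }
    destruct (ratio_surjective rho Hrho) as [y [Hy Ey]].
    set (x := y ^ 2) in *.
    assert (Hx : 0 < x < 1 / 9) by (unfold x; nra).
    pose proof (moment_gf_tail_eq x ltac:(rewrite Rabs_pos_eq; lra)) as EF.
    pose proof (moment_gf_tail_lt x ltac:(lra)) as HF1.
    destruct (moment_gf_ge_hyp x ltac:(lra)) as [_ HF3].
    pose proof (moment_gf_ge_1 x ltac:(lra)) as HF.
    exists ((Cmod b / y - a) / 2). set (c := (Cmod b / y - a) / 2).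
    assert (EA : a + 2 * c = Cmod b / y) by (unfold c; field; lra).
    assert (EB : Cmod b = a * rho) by (unfold rho; field; lra).
    clearbody rho.
    (* Since [3 F <= F1 < 9 F], the ratio [rho = y F1 / (3 F)] lies between [y]
       and [3 y]: the first bound gives [0 <= c], the second [c < a]. *)
    assert (Hrho1 : y <= rho).
    { assert (3 * moment_gf x <= moment_gf_tail x) by (apply Rmult_le_reg_l with x; lra).
      apply Rmult_le_reg_r with (3 * moment_gf x); [lra|]. nra. }
    assert (Hrho2 : rho < 3 * y).
    { apply Rmult_lt_reg_r with (3 * moment_gf x); [lra|]. nra. }
    assert (Hc0 : 0 <= c).
    { assert (a <= Cmod b / y); [|unfold c; lra].
      apply Rmult_le_reg_r with y; [lra|]. unfold Rdiv. rewrite Rmult_assoc, Rinv_l by lra.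
      rewrite EB. nra. }
    assert (Hca : c < a).
    { assert (Cmod b / y < 3 * a); [|unfold c; lra].
      apply Rmult_lt_reg_r with y; [lra|]. unfold Rdiv. rewrite Rmult_assoc, Rinv_l by lra.
      rewrite EB. nra. }
    assert (E1 : moment_gf x * (1 - 3 * rho * y) = 1).
    { assert (y * (y * moment_gf_tail x) = y * (3 * rho * moment_gf x)) by (now rewrite Ey).
      unfold x in *. lra. }
    assert (H3 : 0 < 1 - 3 * rho * y) by nra.
    assert (Hpd : 3 * Cmod b ^ 2 < a * (a + 2 * c)).
    { rewrite EA, EB. apply Rmult_lt_reg_r with y; [lra|].
      replace (a * (a * rho / y) * y) with (a ^ 2 * rho) by (field; lra).
      assert (0 < a ^ 2 * rho * (1 - 3 * rho * y)).
      { apply Rmult_lt_0_compat; [apply Rmult_lt_0_compat; [apply pow_lt|]|]; lra. }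
      lra. }
    assert (Hx' : Cmod b ^ 2 / (a + 2 * c) ^ 2 = x).
    { rewrite EA. unfold x. field. lra. }
    assert (Hz : hyp_argument a b c = cubic_arg x).
    { rewrite hyp_argument_cubic_arg, Hx'; [reflexivity|lra|nra]. }
    pose proof (cubic_arg_bounds x ltac:(lra)) as Hzb.
    unfold admissible. rewrite Hz. split; [|split; [|split]].
    + exact Hc0.
    + rewrite Rabs_pos_eq; lra.
    + pose proof (moment_gf_hypergeometric x ltac:(lra)) as EH.
      replace ((a + 2 * c) ^ 2 / ((a + 2 * c) ^ 2 - 3 * Cmod b ^ 2)) with (/ (1 - 3 * x)).
      2:{ rewrite <- Hx'. field. split; [|lra]. nra. }
      rewrite <- EH.
      replace (a ^ 2 + 2 * a * c) with (a * (a + 2 * c)) by ring.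
      replace (moment_gf x) with (/ (1 - 3 * rho * y)).
      2:{ apply Rmult_eq_reg_r with (1 - 3 * rho * y); [|lra]. rewrite E1. apply Rinv_l. lra. }
      rewrite EA, EB. field. split; [lra|split; [lra|]].
      replace (a * (a * rho) - 3 * (a * rho) ^ 2 * y)
        with (a * a * rho * (1 - 3 * rho * y)) by ring.
      apply Rgt_not_eq. repeat apply Rmult_lt_0_compat; lra.
    + apply pos_def_suff; lra.
Qed.

Lemma solution_bound (a : R) (b p0 p1 : C) :
  is_solution a b p0 p1 -> Cmod b < a.
Proof.
  intros [Hs [Ha Hb]]. apply stable_dominant in Hs.
  rewrite fourier_coeff_000 in Ha by exact Hs. rewrite fourier_coeff_100 in Hb by exact Hs.
  pose proof (dominant_ratio p0 p1 Hs) as Hw.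
  set (y := Cmod (p1 / p0)) in *.
  fold (moment_gf (y ^ 2)) in Ha. fold (moment_gf_tail (y ^ 2)) in Hb.
  assert (Hx : 0 <= y ^ 2 < 1 / 9) by nra.
  pose proof (moment_gf_tail_lt _ Hx) as HF1. pose proof (moment_gf_ge_1 _ Hx) as HF.
  assert (Hc0 : 0 < Cmod p0) by (pose proof (Cmod_ge_0 p1); lra).
  assert (Hp0 : 0 < Cmod p0 ^ 2) by now apply pow_lt.
  apply RtoC_inj in Ha. rewrite <- Ha, <- Hb.
  rewrite Cmod_mult, Cmod_opp, Cmod_R. fold y.
  rewrite Rabs_pos_eq by (apply Rdiv_le_0_compat; lra).
  apply Rmult_lt_reg_r with (Cmod p0 ^ 2); [exact Hp0|].
  replace (y * (moment_gf_tail (y ^ 2) / (3 * Cmod p0 ^ 2)) * Cmod p0 ^ 2)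
    with (y * moment_gf_tail (y ^ 2) / 3)
    by (field; lra).
  replace (moment_gf (y ^ 2) / Cmod p0 ^ 2 * Cmod p0 ^ 2) with (moment_gf (y ^ 2)) by (field; lra).
  nra.
Qed.

(** The meaning of admissibility: [x] lies in the disk of stability, and the equation
    for [c] prescribes [F(x)]. *)
Lemma admissible_facts (a : R) (b : C) (c : R) :
  admissible a b c ->
  let A := a + 2 * c in let x := Cmod b ^ 2 / A ^ 2 in
  0 < a /\ a <= A /\ 3 * Cmod b ^ 2 < a * A /\ 0 <= x < 1 / 9 /\
  moment_gf x = a * A / (a * A - 3 * Cmod b ^ 2).
Proof.
  intros [Hc [Harg [Heq Hpd]]] A x. apply pos_def_nec in Hpd. destruct Hpd as [Ha Hb].
  fold A in Hb.
  assert (HA : a <= A) by (unfold A; lra).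
  pose proof (pow2_ge_0 (Cmod b)) as Hb2.
  assert (HAA : 3 * Cmod b ^ 2 < A ^ 2) by nra.
  assert (HA2 : 0 < A ^ 2) by nra.
  assert (Hx0 : 0 <= x) by (unfold x; apply Rdiv_le_0_compat; lra).
  assert (Hx3 : x < 1 / 3).
  { unfold x. apply Rmult_lt_reg_r with (A ^ 2); [lra|].
    unfold Rdiv. rewrite Rmult_assoc, Rinv_l; lra. }
  rewrite hyp_argument_cubic_arg in Harg, Heq by (fold A; lra). fold A x in Harg, Heq.
  assert (Hx9 : x < 1 / 9).
  { pose proof (cubic_arg_compl x Hx3) as E. pose proof (Rle_abs (cubic_arg x)).
    assert (0 < (1 - 3 * x) ^ 3) by (apply pow_lt; lra).
    assert (1 - 9 * x = (1 - cubic_arg x) * (1 - 3 * x) ^ 3) by (rewrite E; field; lra).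
    assert (0 < (1 - cubic_arg x) * (1 - 3 * x) ^ 3) by (apply Rmult_lt_0_compat; lra).
    lra. }
  repeat split; try lra.
  rewrite moment_gf_hypergeometric by lra.
  replace (a * A - 3 * Cmod b ^ 2) with (a ^ 2 + 2 * a * c - 3 * Cmod b ^ 2)
    by (unfold A; ring).
  rewrite Heq. f_equal. unfold x. field. lra.
Qed.

Lemma matrix_equation_solvable (a : R) (b : C) (c : R) :
  admissible a b c -> exists p0 p1 : C, solves_matrix_equation a b c p0 p1.
Proof.
  intros Hadm. destruct (admissible_facts a b c Hadm) as (Ha & HA & HB & _).
  set (A := a + 2 * c) in *. set (D := a * A - 3 * Cmod b ^ 2).
  assert (HD : 0 < A / D) by (apply Rdiv_lt_0_compat; unfold D; lra).
  set (r := sqrt (A / D)).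
  assert (Hr : 0 < r) by now apply sqrt_lt_R0.
  assert (Er : r ^ 2 = A / D) by (apply pow2_sqrt; lra).
  exists (RtoC r), (- b * RtoC (r / A))%C.
  apply solves_matrix_equation_iff. fold A.
  rewrite Cmod_R, Rabs_pos_eq by lra.
  replace (Cconj (RtoC r)) with (RtoC r) by (apply injective_projections; simpl; ring).
  replace (- b * RtoC (r / A) * RtoC r)%C with (- b * RtoC (/ D))%C.
  2:{ rewrite <- Cmult_assoc, <- RtoC_mult. f_equal. f_equal.
      replace (r / A * r) with (r ^ 2 / A) by (unfold Rdiv; ring).
      rewrite Er. unfold D. field. split; lra. }
  rewrite Er. split.
  - replace (RtoC a * RtoC (A / D) + RtoC 3 * Cconj b * (- b * RtoC (/ D)))%C
      with (RtoC (a * (A / D)) - RtoC 3 * (b * Cconj b) * RtoC (/ D))%C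
      by (rewrite RtoC_mult; ring).
    rewrite <- Cmod2_conj, <- !RtoC_mult, <- RtoC_minus. f_equal.
    unfold D. field. lra.
  - unfold Rdiv. rewrite RtoC_mult. ring.
Qed.

Lemma matrix_equation_solution (a : R) (b : C) (c : R) (p0 p1 : C) :
  admissible a b c -> solves_matrix_equation a b c p0 p1 -> is_solution a b p0 p1.
Proof.
  intros Hadm Hsol.
  destruct (admissible_facts a b c Hadm) as (Ha & HA & HB & Hx & HF).
  apply solves_matrix_equation_iff in Hsol. destruct Hsol as [S1 S2].
  set (A := a + 2 * c) in *. set (x := Cmod b ^ 2 / A ^ 2) in *.
  set (D := a * A - 3 * Cmod b ^ 2) in *.
  assert (HD : 0 < D) by (unfold D; lra).
  assert (HAC : RtoC A <> RtoC 0) by (intros E; apply RtoC_inj in E; lra).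
  set (v := (p1 * Cconj p0)%C) in *. set (u := Cmod p0 ^ 2) in *.
  assert (Ev : v = (- (b * RtoC u) / RtoC A)%C).
  { replace (- (b * RtoC u))%C with (RtoC A * v)%C; [field; exact HAC|].
    replace (RtoC A * v)%C with ((b * RtoC u + RtoC A * v) - b * RtoC u)%C by ring.
    rewrite S2. ring. }
  assert (Eu : u = A / D).
  { rewrite Ev in S1.
    replace (RtoC a * RtoC u + RtoC 3 * Cconj b * (- (b * RtoC u) / RtoC A))%C
      with (RtoC a * RtoC u - RtoC 3 * (b * Cconj b) * (RtoC u / RtoC A))%C in S1
      by (field; exact HAC).
    rewrite <- Cmod2_conj, <- RtoC_div, <- !RtoC_mult, <- RtoC_minus in S1 by lra.
    apply RtoC_inj in S1.
    assert (E : u * (D / A) = 1) by (rewrite <- S1; unfold D; field; lra).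
    replace (A / D) with (/ (D / A)) by (field; lra).
    rewrite <- (Rmult_1_l (/ (D / A))), <- E. field. lra. }
  assert (Hp0 : p0 <> RtoC 0).
  { intros E0. unfold u in Eu. rewrite E0, Cmod_0 in Eu.
    assert (0 < A / D) by (apply Rdiv_lt_0_compat; lra). lra. }
  assert (Hcp0 : Cconj p0 <> RtoC 0).
  { apply Cmod_gt_0. rewrite Cmod_conj. now apply Cmod_gt_0. }
  assert (Ew : (p1 / p0)%C = (- b / RtoC A)%C).
  { replace (p1 / p0)%C with (p1 * Cconj p0 / (p0 * Cconj p0))%C by (field; auto).
    rewrite <- Cmod2_conj. fold u v. rewrite Ev. field.
    split; [exact HAC|]. intros E. apply RtoC_inj in E.
    assert (0 < A / D) by (apply Rdiv_lt_0_compat; lra). lra. }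
  assert (Hw : Cmod (p1 / p0) ^ 2 = x).
  { rewrite Ew, Cmod_div, Cmod_opp, Cmod_R, Rabs_pos_eq by (auto; lra).
    unfold x. field. lra. }
  assert (Hs : 3 * Cmod p1 < Cmod p0).
  { assert (Hp0' : 0 < Cmod p0) by now apply Cmod_gt_0.
    pose proof (Cmod_ge_0 (p1 / p0)).
    assert (Cmod (p1 / p0) < 1 / 3) by nra.
    replace p1 with (p1 / p0 * p0)%C by (field; auto). rewrite Cmod_mult. nra. }
  split; [now apply stable_dominant|].
  rewrite fourier_coeff_000, fourier_coeff_100 by exact Hs.
  fold u. rewrite Hw, Eu, Ew. fold (moment_gf x) (moment_gf_tail x). split.
  - f_equal. rewrite HF. field. lra.
  - destruct (Req_dec (Cmod b) 0) as [Hb0|Hb0].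
    + apply Cmod_eq_0 in Hb0. rewrite Hb0. field. exact HAC.
    + assert (Hx0 : 0 < x).
      { unfold x. apply Rdiv_lt_0_compat; [|nra]. pose proof (Cmod_ge_0 b). nra. }
      assert (EF1 : moment_gf_tail x / (3 * (A / D)) = A).
      { pose proof (moment_gf_tail_eq x ltac:(rewrite Rabs_pos_eq; lra)) as E.
        replace (moment_gf_tail x) with ((moment_gf x - 1) / x) by (rewrite E; field; lra).
        rewrite HF. unfold x, D. field. repeat split; nra. }
      rewrite EF1. field. exact HAC.
Qed.

Theorem theorem1p3 (a : R) (b : C) :
  ((exists p0 p1 : C, is_solution a b p0 p1) <-> Cmod b < a) /\
  (Cmod b < a ->
     (exists c : R, admissible a b c) /\
     (forall c : R, admissible a b c ->
        (exists p0 p1 : C, solves_matrix_equation a b c p0 p1) /\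
        (forall p0 p1 : C, solves_matrix_equation a b c p0 p1 ->
           is_solution a b p0 p1))).
Proof.
  split; [split|].
  - intros [p0 [p1 Hs]]. exact (solution_bound a b p0 p1 Hs).
  - intros Hba. destruct (admissible_exists a b Hba) as [c Hc].
    destruct (matrix_equation_solvable a b c Hc) as [p0 [p1 Hp]].
    exists p0, p1. exact (matrix_equation_solution a b c p0 p1 Hc Hp).
  - intros Hba. split; [exact (admissible_exists a b Hba)|].
    intros c Hc. split; [exact (matrix_equation_solvable a b c Hc)|].
    intros p0 p1. exact (matrix_equation_solution a b c p0 p1 Hc).
Qed.
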